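(* Let $X$ be a building of finite rank. The set $\mathscr{C}_1(X)$ is the union of the sets $\mathscr{C}_1(A)$ taken over all apartments $A$ of $X$. Similarly, $\mathscr{C}_{\mathrm{sph}}(X)$ is the union of the sets $\mathscr{C}_{\mathrm{sph}}(A)$ taken over all apartments $A$ of $X$.
   Context: Conventions on buildings. $X$ is a building of finite rank and of arbitrary type $(W,S)$ (not assumed locally finite), with its full apartment system. A residue of type $J\subset S$ is spherical if $W_J=\langle J\rangle$ is finite. Residues are viewed as simplices: we write $R\subset R'$ if, as sets of chambers, $R'$ is a subset of $R$; thus chambers are the maximal spherical residues and panels are the rank one residues. $\mathrm{Ch}(X)$, $\mathrm{Res}_1(X)$, $\mathrm{Res}_{\mathrm{sph}}(X)$ denote the sets of chambers, panels and spherical residues. The star $\mathrm{St}(\sigma)$ is the set of residues $R$ with $\sigma\subset R$ (including $\sigma$). For a chamber $C$, $\mathrm{proj}_\sigma(C)$ is the unique chamber of $\mathrm{St}(\sigma)$ nearest to $C$ for the gallery distance; for a spherical residue $R$, $\mathrm{proj}_\sigma(R)\in\mathrm{St}(\sigma)$ is the residue whose set of chambers is $\{\mathrm{proj}_\sigma(C) : C \text{ a chamber with } R\subset C\}$. Combinatorial bordifications. $\mathscr{C}_1(X)$ is the closure of the image of the injective map $\mathrm{Ch}(X)\to\prod_{\sigma\in\mathrm{Res}_1(X)}\mathrm{St}(\sigma)$, $C\mapsto(\sigma\mapsto\mathrm{proj}_\sigma(C))$, and $\mathscr{C}_{\mathrm{sph}}(X)$ is the closure of the image of the injective map $\mathrm{Res}_{\mathrm{sph}}(X)\to\prod_{\sigma\in\mathrm{Res}_{\mathrm{sph}}(X)}\mathrm{St}(\sigma)$,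 $R\mapsto(\sigma\mapsto\mathrm{proj}_\sigma(R))$; stars are discrete and products carry the product topology. Chambers and spherical residues are identified with their images. For an apartment $A$ of $X$, $\mathscr{C}_1(A)\subset\mathscr{C}_1(X)$ denotes the set of limits in $\mathscr{C}_1(X)$ of sequences of chambers of $A$, and $\mathscr{C}_{\mathrm{sph}}(A)\subset\mathscr{C}_{\mathrm{sph}}(X)$ the set of limits in $\mathscr{C}_{\mathrm{sph}}(X)$ of sequences of spherical residues contained in $A$. *)

(* Defs.v *)
From HB Require Import structures.
From mathcomp Require Import all_boot all_order all_algebra.
From mathcomp Require Import all_classical all_reals all_analysis.

Set Implicit Arguments.
Unset Strict Implicit.
Unset Printing Implicit Defensive.

Local Open Scope classical_set_scope.
Local Open Scope group_scope.

Section Groups.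
Variable G : groupType.

Definition subgroup (H : set G) : Prop :=
  H 1 /\ (forall x y, H x -> H y -> H (x / y)).

Definition generated (A : set G) : set G := smallest subgroup A.

Definition is_order (x : G) (n : nat) : Prop :=
  [/\ 0 < n, x ^+ n = 1 & forall m, 0 < m < n -> x ^+ m <> 1].

Variables (S : finType) (g : S -> G).

Definition word_prod (u : seq S) : G := \prod_(s <- u) g s.

(* The congruence on words generated by (st)^{m(s,t)} ~ 1, for s, t such that
   the order m(s,t) of st is finite.  When g s is an involution, the case s = t
   is the relation ss ~ 1, so that every letter is its own inverse modulo the
   congruence: no formal inverses are needed to present a group. *)
Inductive coxeter_rel : seq S -> seq S -> Prop :=
| CoxeterRefl u : coxeter_rel u u
| CoxeterSym u v : coxeter_rel u v -> coxeter_rel v u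
| CoxeterTrans u v w :
    coxeter_rel u v -> coxeter_rel v w -> coxeter_rel u w
| CoxeterCancel u v s t m : is_order (g s * g t) m ->
    coxeter_rel (u ++ flatten (nseq m [:: s; t]) ++ v) (u ++ v).

End Groups.

(* (W, S) with S finite: S is a set of involutions generating W, and W is
   presented by S subject to the relations (st)^{m(s,t)} = 1. *)
Record coxeter_system := CoxeterSystem {
  cox_group :> groupType;
  cox_type : finType;
  cox_gen : cox_type -> cox_group;
  cox_gen_inj : injective cox_gen;
  cox_gen_order2 : forall s, is_order (cox_gen s) 2;
  cox_generated : generated (range cox_gen) = [set: cox_group];
  cox_presented : forall u v : seq cox_type,
    word_prod cox_gen u = word_prod cox_gen v -> coxeter_rel cox_gen u v
}.

Section Coxeter.
Variable W : coxeter_system.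
Local Notation S := (cox_type W).

Lemma cox_gen_sq (s : S) : cox_gen s * cox_gen s = 1.
Proof. by have [_ + _] := cox_gen_order2 s. Qed.

Lemma word_prod_rev (u : seq S) :
  word_prod (@cox_gen W) (rev u) = (word_prod (@cox_gen W) u)^-1.
Proof.
rewrite /word_prod; elim: u => [|s u IH]; first by rewrite !big_nil invg1.
rewrite rev_cons -cats1 big_cat big_seq1 big_cons invgM -IH; congr (_ * _).
by apply: (mulgI (cox_gen s)); rewrite mulgV cox_gen_sq.
Qed.

Lemma word_prod_surj (w : W) : exists u : seq S, word_prod (@cox_gen W) u = w.
Proof.
suff H : range (word_prod (@cox_gen W)) w by have [u _ <-] := H; exists u.
have : generated (range (@cox_gen W)) w by rewrite cox_generated.
apply; split=> [|_ [s _ <-]]; last by exists [:: s] => //; apply: big_seq1.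
split=> [|_ _ [u _ <-] [v _ <-]]; first by exists [::] => //; apply: big_nil.
by exists (u ++ rev v) => //; rewrite -word_prod_rev /word_prod big_cat.
Qed.

Definition word_of_size (w : W) (n : nat) : bool :=
  [exists u : n.-tuple S, word_prod (@cox_gen W) u == w].

Lemma word_of_size_ex (w : W) : exists n, word_of_size w n.
Proof.
have [u uw] := word_prod_surj w; exists (size u).
by apply/existsP; exists (in_tuple u); apply/eqP.
Qed.

Definition cox_length (w : W) : nat := ex_minn (word_of_size_ex w).

Definition parabolic (J : {set S}) : set W :=
  generated [set cox_gen s | s in [set` J]].

End Coxeter.

(* Buildings of type (W, S) as W-metric spaces. *)
Record building (W : coxeter_system) := Building {
  chamber :> choiceType;
  delta : chamber -> chamber -> W;
  building_nonempty : [set: chamber] !=set0;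
  delta_eq1 : forall C D, delta C D = 1 <-> C = D;
  delta_adj : forall (s : cox_type W) (C C' D : chamber),
    delta C' C = cox_gen s ->
    delta C' D = cox_gen s * delta C D \/ delta C' D = delta C D;
  delta_adj_len : forall (s : cox_type W) (C C' D : chamber),
    delta C' C = cox_gen s ->
    cox_length (cox_gen s * delta C D) = (cox_length (delta C D)).+1 ->
    delta C' D = cox_gen s * delta C D;
  delta_ex : forall (s : cox_type W) (C D : chamber),
    exists2 C', delta C' C = cox_gen s & delta C' D = cox_gen s * delta C D
}.

Section Building.
Variables (W : coxeter_system) (X : building W).
Local Notation S := (cox_type W).

Definition adjacent : rel X :=
  fun C D => [exists s : S, delta C D == cox_gen s].

Lemma adjacent_sym : symmetric adjacent.
Proof.
suff H C D : adjacent C D -> adjacent D C.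
  by move=> C D; apply/idP/idP; apply: H.
case/existsP => s /eqP CD; apply/existsP; exists s; apply/eqP.
have := delta_adj C CD; rewrite (delta_eq1 C C).2//.
case=> [e|/esym/delta_eq1 DC].
  by apply: (mulgI (cox_gen s)); rewrite -e cox_gen_sq.
have [_ _ /(_ 1%N isT)] := cox_gen_order2 s.
by rewrite /= -CD DC (delta_eq1 C C).2.
Qed.

Definition gallery (C D : X) (n : nat) : Prop :=
  exists p : seq X, [/\ size p = n, path adjacent C p & last C p = D].

Lemma gallery_ex (C D : X) : exists n, `[< gallery C D n >].
Proof.
have [u] := word_prod_surj (delta C D).
elim: u C => [|s u IH] C; rewrite /word_prod ?big_nil ?big_cons => uCD.
  by exists 0; apply/asboolP; exists [::]; split=> //=; apply/delta_eq1.
have [C' C'C C'D] := delta_ex s C D.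
have : word_prod (@cox_gen W) u = delta C' D.
  by rewrite C'D -uCD mulgA cox_gen_sq mul1g.
move=> /IH [n /asboolP[p [pn pp pl]]].
exists n.+1; apply/asboolP; exists (C' :: p); split=> //=; first by rewrite pn.
rewrite pp andbT adjacent_sym; apply/existsP; exists s; exact/eqP.
Qed.

Definition gallery_dist (C D : X) : nat := ex_minn (gallery_ex C D).

(* Residues are encoded by their sets of chambers. *)
Definition residue_of (J : {set S}) (C : X) : set X :=
  [set D | parabolic J (delta C D)].

Definition residues : set (set X) :=
  [set R | exists J C, R = residue_of J C].

Definition panels : set (set X) :=
  [set R | exists s C, R = residue_of [set s] C].

Definition spherical_residues : set (set X) :=
  [set R | exists J C, finite_set (parabolic J) /\ R = residue_of J C].

Lemma panels_residues : panels `<=` residues.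
Proof. by move=> R [s [C ->]]; exists [set s]%SET, C. Qed.

Lemma spherical_residues_residues : spherical_residues `<=` residues.
Proof. by move=> R [J [C [_ ->]]]; exists J, C. Qed.

(* The order of simplices is reverse inclusion of sets of chambers. *)
Definition star (s : set X) : set (set X) :=
  [set R | residues R /\ R `<=` s].

Lemma star_self (s : set X) : residues s -> s \in star s.
Proof. by move=> sR; apply/mem_set; split. Qed.

Definition nearest (s : set X) (C : X) : set X :=
  [set D | s D /\ forall E, s E -> gallery_dist C D <= gallery_dist C E].

(* For s a residue, nearest s C is a singleton; the default value is
   immaterial. *)
Definition proj_chamber (s : set X) (C : X) : X := xget C (nearest s C).

(* The default value, s itself, is never used when R is a chamber or when s and
   R are spherical residues, since then proj_chamber s @` R is a residue. *)
Definition proj_residue (s : set X) (sR : residues s) (R : set X) : star s :=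
  xget (SigSub (star_self sR))
    [set E : star s | val E = proj_chamber s @` R].

Definition star_prod (I : set (set X)) : Type :=
  prod_topology (fun s : I => discrete_topology (star (val s))).

HB.instance Definition _ (I : set (set X)) :=
  Topological.on (star_prod I).

Definition proj_family (I : set (set X)) (IR : I `<=` residues) (R : set X) :
  star_prod I := fun s => proj_residue (IR _ (set_valP s)) R.

(* A chamber C is the residue [set C], of empty type. *)
Definition chamber_embed (C : X) : star_prod panels :=
  proj_family panels_residues [set C].

Definition residue_embed (R : spherical_residues) :
  star_prod spherical_residues :=
  proj_family spherical_residues_residues (val R).

Definition bord1 : set (star_prod panels) := closure (range chamber_embed).

Definition bord_sph : set (star_prod spherical_residues) :=
  closure (range residue_embed).

(* Apartments of the full apartment system, as sets of chambers: the images of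
   the isometries from W, with distance (v, w) |-> v^-1 w, to X. *)
Definition apartments : set (set X) :=
  [set A | exists2 f : W -> X,
     (forall v w, delta (f v) (f w) = v^-1 * w) & A = range f].

Definition bord1_apt (A : set X) : set (star_prod panels) :=
  [set xi | bord1 xi /\ exists u : nat -> X,
     (forall n, A (u n)) /\ chamber_embed (u n) @[n --> \oo] --> xi].

(* A residue is contained in A as a simplex, that is, as a face of some chamber
   of A, iff its set of chambers meets A; that set need not be a subset of A. *)
Definition bord_sph_apt (A : set X) : set (star_prod spherical_residues) :=
  [set xi | bord_sph xi /\ exists u : nat -> spherical_residues,
     (forall n, val (u n) `&` A !=set0) /\
     residue_embed (u n) @[n --> \oo] --> xi].

End Building.

Arguments residues {W} X _.
Arguments panels {W} X _.
Arguments spherical_residues {W} X _.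
Arguments bord1 {W} X _.
Arguments bord_sph {W} X _.
Arguments apartments {W} X _.

(* Main.v *)
Require Import Defs.
From mathcomp Require Import all_boot all_order all_algebra.
From mathcomp Require Import all_classical all_reals all_analysis.
From mathcomp Require Import zify.

(* Write W_J-cosets through their shortest elements: for a residue R of type J and
   a chamber y, let w_y(R) be the distance from y to its gate on R. A point xi of
   either bordification is a limit along a filter of residues R; it decides, for
   every panel of type s at y, whether s shortens w_y(R) (and then which chamber of
   the panel is closer to R), or satisfies s w_y(R) in w_y(R) W_J (y is flat in the
   direction s), or neither. Let K_y be the set of flat directions at y.
   Call c reachable from y if c is, for R near the limit, on a geodesic from y to
   the gate of y, and write y < c when moreover delta y c conjugates K_y into S.
   The weak order of W has meets, and the set of all b above given elements a which
   conjugate given K into S is closed under meets. Hence it has a least element,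
   which is below w_y(R) for all R near the limit because w_y(R) itself belongs to
   the set. So two chambers reachable from y have a common successor for <, and, by
   induction on galleries, for any x and z there are x < c and z < d with c and d in
   the same flat, i.e. with d in the residue of type K_c of c. Since a chamber
   reachable from x is determined by its distance from x and W is countable, there
   is a sequence x = u_0 < u_1 < ... such that from some rank on the flat of u_n
   contains a successor of z, for each chamber z. This sequence is isometric to a
   subset of W, so that it lies in an apartment, and the flats of the u_n converge
   to xi. For chambers in place of spherical residues, J and the K_y are empty. *)

Set Implicit Arguments.
Unset Strict Implicit.
Unset Printing Implicit Defensive.

Local Open Scope classical_set_scope.
Local Open Scope group_scope.

(** * Coxeter groups: exchange condition and cosets of parabolic subgroups *)

Ltac gsimp := rewrite ?(invgM, invgK, mulgA, mulgK, mulgVK, mulgV, mulVg,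
  mul1g, mulg1, invg1).

(* Rewriting leaves convertible but syntactically distinct instances of the group
   operations inside the lengths; naming the lengths up to conversion hides them
   from lia. *)
Ltac len_lia :=
  repeat match goal with
    | H : context [@cox_length _ _] |- _ => revert H
  end;
  repeat match goal with
    | |- context [@cox_length ?W ?x] =>
      let n := fresh "n" in move: (@cox_length W x) => n
  end; lia.

Section CoxeterGroups.
Variable W : coxeter_system.
Local Notation S := (cox_type W).
Local Notation g := (@cox_gen W).
Local Notation l := (@cox_length W).
Local Notation wd := (word_prod g).
Implicit Types (s t : S) (u v : seq S) (w x y z a b : W) (J L : {set S}).

Lemma word_prod_nil : wd [::] = 1.
Proof. exact: big_nil. Qed.

Lemma word_prod_cons s u : wd (s :: u) = g s * wd u.
Proof. exact: big_cons. Qed.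

Lemma word_prod_cat u v : wd (u ++ v) = wd u * wd v.
Proof. exact: big_cat. Qed.

Lemma cox_genV s : (g s)^-1 = g s.
Proof. by apply: mulg1_eq; rewrite cox_gen_sq. Qed.

Lemma cox_genK s w : g s * (g s * w) = w.
Proof. by rewrite mulgA cox_gen_sq mul1g. Qed.

Lemma cox_genKr s w : w * g s * g s = w.
Proof. by rewrite -mulgA cox_gen_sq mulg1. Qed.

Lemma cox_length_word u : (l (wd u) <= size u)%N.
Proof.
rewrite /cox_length; case: ex_minnP => m _; apply.
by apply/existsP; exists (in_tuple u); apply/eqP.
Qed.

Lemma reduced_word w : exists2 u, wd u = w & size u = l w.
Proof.
rewrite /cox_length; case: ex_minnP => m /existsP[u /eqP uw] _.
by exists u => //; exact: size_tuple.
Qed.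

(** The reflections [s_1 ... s_(i-1) s_i s_(i-1) ... s_1] attached to the positions [i] of the word;
    multiplying the word on the left by one of them deletes the corresponding letter. *)
Fixpoint inversions u : seq W :=
  if u is s :: u' then g s :: [seq g s * x * g s | x <- inversions u']
  else [::].

Lemma inversions_cat u v :
  inversions (u ++ v) =
  inversions u ++ [seq wd u * x * (wd u)^-1 | x <- inversions v].
Proof.
elim: u => [|s u IH] /=.
  by rewrite word_prod_nil -[LHS]map_id; apply: eq_map => t; gsimp.
rewrite IH map_cat -map_comp word_prod_cons; congr (_ :: _ ++ _).
by apply: eq_map => t /=; rewrite invgM cox_genV !mulgA.
Qed.

Lemma count_conj x z (r : seq W) :
  count_mem z [seq x * y * x^-1 | y <- r] = count_mem (x^-1 * z * x) r.
Proof.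
rewrite count_map; apply: eq_count => y /=.
by apply/eqP/eqP => [<-|->]; gsimp.
Qed.

Lemma inversions_alt s t m :
  inversions (flatten (nseq m [:: s; t])) =
  [seq (g s * g t) ^+ j * g s | j <- iota 0 (m + m)].
Proof.
elim: m => [//|m IH].
have -> : flatten (nseq m.+1 [:: s; t]) =
  [:: s; t] ++ flatten (nseq m [:: s; t]) by [].
rewrite inversions_cat IH addnS addSn /= expg0 expg1 mul1g.
congr [:: _, _ & _].
rewrite -[in RHS]add2n iotaDl -!map_comp; apply: eq_map => j /=.
rewrite !word_prod_cons word_prod_nil mulg1 add2n; set c := g s * g t.
have sc : g s * c^-1 = c * g s by rewrite invgM !cox_genV mulgA.
by rewrite (expgS c j.+1) (expgSr c j) -(mulgA c) -(mulgA _ (g s)) sc !mulgA.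
Qed.

(** For the last invariant: when [(st)^m = 1], the inversions of the relator are [(st)^j s] for
    [j < 2m], that is, one list of length [m] repeated twice, so the relator changes no parity. *)
Lemma coxeter_rel_invariants u v : coxeter_rel g u v ->
  [/\ wd u = wd v, odd (size u) = odd (size v) &
    forall x, odd (count_mem x (inversions u)) =
              odd (count_mem x (inversions v))].
Proof.
elim=> {u v} [//|u v _ [-> -> H]|u v w _ [-> -> H] _ [-> -> H']|].
- by split.
- by split => // x; rewrite H.
move=> u v s t m [_ stm _].
have altE : wd (flatten (nseq m [:: s; t])) = 1.
  rewrite -stm; elim: m {stm} => [|m IH]; first exact: word_prod_nil.
  by rewrite /= !word_prod_cons IH expgS mulgA.
split.
- by rewrite !word_prod_cat altE mul1g.
- rewrite !size_cat !oddD; congr (_ (+) _).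
  suff -> : odd (size (flatten (nseq m [:: s; t]))) = false by [].
  by elim: m {stm altE} => //= m ->.
move=> x; rewrite !inversions_cat !count_cat !oddD; congr (_ (+) _).
rewrite map_cat count_cat oddD !count_conj altE invg1 mulg1 mul1g.
rewrite -[RHS]addFb; congr (_ (+) _).
rewrite inversions_alt iotaD map_cat count_cat oddD.
rewrite add0n (_ : iota m m = map (addn m) (iota 0 m)) -?map_comp; last first.
  by rewrite -iotaDl addn0.
set p := count_mem _ _; set q := count_mem _ _.
suff -> : p = q by rewrite addbb.
rewrite /p /q !count_map; apply: eq_count => j /=.
by rewrite expgnDr stm mul1g.
Qed.

Lemma odd_cox_length u : odd (l (wd u)) = odd (size u).
Proof.
have [v vu <-] := reduced_word (wd u).
by have [] := coxeter_rel_invariants (cox_presented vu).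
Qed.

Lemma cox_length1 : l 1 = 0%N.
Proof. by apply/eqP; rewrite -leqn0 -word_prod_nil cox_length_word. Qed.

Lemma cox_length_eq0 w : l w = 0%N -> w = 1.
Proof.
have [u <- <-] := reduced_word w.
by move/size0nil ->; rewrite word_prod_nil.
Qed.

Lemma cox_lengthM x y : (l (x * y) <= l x + l y)%N.
Proof.
have [u <- <-] := reduced_word x; have [v <- <-] := reduced_word y.
by rewrite -word_prod_cat -size_cat cox_length_word.
Qed.

Lemma cox_lengthV x : l x^-1 = l x.
Proof.
suff H y : (l y^-1 <= l y)%N.
  by apply/eqP; rewrite eqn_leq H -{1}[x]invgK H.
have [u <- <-] := reduced_word y.
by rewrite -word_prod_rev -(size_rev u) cox_length_word.
Qed.

Lemma cox_length_gen s : l (g s) = 1%N.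
Proof.
have := odd_cox_length [:: s]; have := cox_length_word [:: s].
rewrite word_prod_cons word_prod_nil mulg1 /=.
by case: (l _) => [|[]].
Qed.

Lemma cox_length_eq1 w : l w = 1%N -> exists s, w = g s.
Proof.
have [u <- <-] := reduced_word w.
by case: u => [|s [|]] // _; exists s; rewrite word_prod_cons word_prod_nil mulg1.
Qed.

Lemma cox_length_mulgen s w :
  l (g s * w) = (l w).+1 \/ l w = (l (g s * w)).+1.
Proof.
have [u uw _] := reduced_word w.
have := odd_cox_length (s :: u); rewrite word_prod_cons uw /= -odd_cox_length uw.
have := cox_lengthM (g s) w; have := cox_lengthM (g s) (g s * w).
by rewrite cox_genK cox_length_gen; len_lia.
Qed.

Lemma cox_length_mulgenr s w :
  l (w * g s) = (l w).+1 \/ l w = (l (w * g s)).+1.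
Proof.
rewrite -(cox_lengthV w) -(cox_lengthV (w * g s)) invgM cox_genV.
exact: cox_length_mulgen.
Qed.

Lemma mem_inversions x u : x \in inversions u ->
  exists u1 s u2, u = u1 ++ s :: u2 /\ x * wd u = wd (u1 ++ u2).
Proof.
elim: u x => [//|s u IH] x /=; rewrite inE => /orP[/eqP->|/mapP[y yu ->]].
  by exists [::], s, u; rewrite word_prod_cons cox_genK.
have [u1 [t [u2 [-> e]]]] := IH y yu.
exists (s :: u1), t, u2; split=> //=.
by rewrite word_prod_cons -mulgA cox_genK -mulgA e word_prod_cons.
Qed.

(* A letter s with l(s w) < l(w) occurs once among the inversions of the word s v
   for v a reduced word of s w, hence an odd number of times in any word of w. *)
Lemma exchange s u : (l (g s * wd u) < l (wd u))%N ->
  exists u1 t u2, u = u1 ++ t :: u2 /\ g s * wd u = wd (u1 ++ u2).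
Proof.
move=> ltl; apply: mem_inversions.
have [v vE vs] := reduced_word (g s * wd u).
have svE : wd (s :: v) = wd u by rewrite word_prod_cons vE cox_genK.
have [_ _ /(_ (g s))] := coxeter_rel_invariants (cox_presented svE).
rewrite /= eqxx -[X in map (fun _ => _ * X)]cox_genV count_conj.
rewrite cox_genV cox_gen_sq mul1g (_ : count_mem _ _ = 0%N); last first.
  apply/count_memPn/negP => /mem_inversions[v1 [t [v2 [vv]]]].
  rewrite vE cox_genK => e; have := cox_length_word (v1 ++ v2).
  by move: vs; rewrite -e vv !size_cat /=; len_lia.
by move=> /esym cu; rewrite -has_pred1 has_count; case: count cu.
Qed.

Lemma deletion u : (l (wd u) < size u)%N ->
  exists u', [/\ subseq u' u, (size u' < size u)%N & wd u' = wd u].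
Proof.
elim: u => [//|s u IH]; rewrite word_prod_cons /= ltnS => lu.
have [lt|ge] := ltnP (l (wd u)) (size u).
  have [u' [u'u su e]] := IH lt; exists (s :: u'); split=> //=.
    by rewrite eqxx.
  by rewrite !word_prod_cons e.
have [|u1 [t [u2 [-> e]]]] := @exchange s u.
  by have := cox_length_mulgen s (wd u); len_lia.
exists (u1 ++ u2); split=> //; last by rewrite !size_cat /=; len_lia.
by apply: subseq_trans (subseq_cons _ s); rewrite cat_subseq ?subseq_cons.
Qed.

Lemma reduced_subword u :
  exists u', [/\ subseq u' u, size u' = l (wd u) & wd u' = wd u].
Proof.
have [n] := ubnP (size u); elim: n u => [//|n IH] u; rewrite ltnS => un.
have [lt|ge] := ltnP (l (wd u)) (size u); last first.
  by exists u; split=> //; apply/eqP; rewrite eqn_leq ge cox_length_word.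
have [v [vu sv e]] := deletion lt.
have [u' [uv su eu]] := IH v (leq_trans sv un).
by exists u'; rewrite -e; split=> //; apply: subseq_trans vu.
Qed.

Lemma parabolic1 J : parabolic J 1.
Proof. by move=> H [K _]; case: K. Qed.

Lemma parabolicV J x : parabolic J x -> parabolic J x^-1.
Proof.
move=> Jx H HJ; have [[H1 HV] _] := HJ; rewrite -[_^-1]mul1g.
by apply: HV => //; apply: Jx.
Qed.

Lemma parabolicM J x y : parabolic J x -> parabolic J y -> parabolic J (x * y).
Proof.
move=> Jx Jy H HJ; have [[H1 HV] _] := HJ; rewrite -[y]invgK.
by apply: HV; [exact: Jx|exact: (parabolicV Jy HJ)].
Qed.

Lemma parabolic_gen J s : s \in J -> parabolic J (g s).
Proof. by move=> sJ H [_]; apply; exists s. Qed.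

Lemma parabolic_word J u : {subset u <= J} -> parabolic J (wd u).
Proof.
elim: u => [|s u IH] uJ; first by rewrite word_prod_nil; exact: parabolic1.
rewrite word_prod_cons; apply: parabolicM.
  by apply: parabolic_gen; apply: uJ; rewrite mem_head.
by apply: IH => t tu; apply: uJ; rewrite inE tu orbT.
Qed.

Lemma parabolic_reduced J x : parabolic J x ->
  exists u, [/\ {subset u <= J}, wd u = x & size u = l x].
Proof.
move=> Jx; have [u uJ ux] : exists2 u, {subset u <= J} & wd u = x.
  apply: (Jx [set x | exists2 u, {subset u <= J} & wd u = x]); split.
    split; first by exists [::] => //; exact: word_prod_nil.
    move=> _ _ [u uJ <-] [v vJ <-]; exists (u ++ rev v).
      by move=> s; rewrite mem_cat mem_rev => /orP[/uJ|/vJ].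
    by rewrite word_prod_cat word_prod_rev.
  move=> _ [s sJ <-]; exists [:: s]; first by move=> t; rewrite inE => /eqP->.
  by rewrite word_prod_cons word_prod_nil mulg1.
have [v [vu sv e]] := reduced_subword u.
exists v; split; [|by rewrite e|by rewrite sv ux].
by move=> s /(mem_subseq vu)/uJ.
Qed.

Lemma parabolic_ind J (P : W -> Prop) : P 1 ->
  (forall s x, s \in J -> parabolic J x -> l (g s * x) = (l x).+1 -> P x ->
     P (g s * x)) ->
  forall x, parabolic J x -> P x.
Proof.
move=> P1 PS x /parabolic_reduced[u [uJ ux su]].
elim: u x uJ ux su => [|s u IH] x uJ; rewrite ?word_prod_nil ?word_prod_cons.
  by move=> <-.
move=> <- su; have uJ' : {subset u <= J}.
  by move=> t tu; apply: uJ; rewrite inE tu orbT.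
have e : size u = l (wd u).
  by move: su (cox_length_word u) => /=; have := cox_length_mulgen s (wd u); len_lia.
apply: PS; [by apply: uJ; rewrite mem_head|exact: parabolic_word| |exact: IH].
by rewrite -su -e.
Qed.

Lemma parabolicS J L x : {subset J <= L} -> parabolic J x -> parabolic L x.
Proof.
move=> JL /parabolic_reduced[u [uJ <- _]].
by apply: parabolic_word => s /uJ/JL.
Qed.

Lemma parabolic_set0 x : parabolic (finset.set0 : {set S}) x -> x = 1.
Proof.
by move: x; apply: parabolic_ind => // s x; rewrite inE.
Qed.

Lemma parabolic_set1 s x : parabolic [set s]%SET x -> x = 1 \/ x = g s.
Proof.
move: x; apply: parabolic_ind => [|t x]; first by left.
rewrite inE => /eqP-> _ _ [->|->]; first by right; rewrite mulg1.
by left; rewrite cox_gen_sq.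
Qed.

Lemma parabolicT x : parabolic [set: S]%SET x.
Proof.
by have [u <- _] := reduced_word x; apply: parabolic_word => s; rewrite inE.
Qed.

Lemma cox_ind (P : W -> Prop) : P 1 ->
  (forall s x, l (g s * x) = (l x).+1 -> P x -> P (g s * x)) ->
  forall x, P x.
Proof.
move=> P1 PS x; apply: parabolic_ind (parabolicT x) => // s y _ _.
exact: PS.
Qed.

Definition lreduced J w : Prop := forall s, s \in J -> l (g s * w) = (l w).+1.
Definition rreduced J w : Prop := forall s, s \in J -> l (w * g s) = (l w).+1.

Lemma min_coset J (v : W) : exists x (v0 : W), [/\ parabolic J x, v = x * v0 &
  forall y, parabolic J y -> (l v0 <= l (y * v0))%N].
Proof.
pose P n := `[< exists x, parabolic J x /\ l (x * v) = n >].
have exP : exists n, P n.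
  by exists (l v); apply/asboolP; exists 1; rewrite mul1g; split=> //; exact: parabolic1.
case: (ex_minnP exP) => m /asboolP[x [Jx xm]] min.
exists x^-1, (x * v); split=> [||y Jy]; [exact: parabolicV|by gsimp|].
rewrite xm; apply: min; apply/asboolP; exists (y * x); rewrite mulgA.
by split=> //; apply: parabolicM.
Qed.

(** Extract a reduced subword from the concatenation of reduced words of [x] and [v0]. What remains
    of the second word represents an element of [W_J v0], so by minimality no letter of it is
    deleted; the first part then still spells [x]. *)
Lemma min_coset_add J (v0 : W) x :
  (forall y, parabolic J y -> (l v0 <= l (y * v0))%N) -> parabolic J x ->
  l (x * v0) = (l x + l v0)%N.
Proof.
move=> min Jx; have [u [uJ ux su]] := parabolic_reduced Jx.
have [v vv0 sv] := reduced_word v0.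
have [z [zuv sz zE]] := reduced_subword (u ++ v).
have /subseqP[m sm zm] := zuv.
move: zE sz; rewrite zm -(cat_take_drop (size u) m) mask_cat; last first.
  by rewrite size_takel// sm size_cat leq_addr.
set z1 := mask _ u; set z2 := mask _ v.
rewrite !word_prod_cat size_cat ux vv0 => zE sz.
have Jz1 : parabolic J (wd z1).
  by apply: parabolic_word => s /mem_mask/uJ.
have z2E : wd z2 = (wd z1)^-1 * x * v0 by rewrite -mulgA -zE mulKg.
have sz2 : (l v0 <= size z2)%N.
  apply: leq_trans (cox_length_word z2); rewrite z2E; apply: min.
  by apply: parabolicM => //; apply: parabolicV.
have z2v : z2 = v.
  apply/eqP; rewrite -(size_subseq_leqif (mask_subseq _ _)).
  by rewrite eqn_leq size_subseq ?mask_subseq// sv.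
have z1x : wd z1 = x by move: zE; rewrite z2v vv0 => /mulIg.
have := cox_length_word z1; have := cox_lengthM x v0.
by rewrite z1x; move: sz; rewrite z2v sv; len_lia.
Qed.

(** The local condition forces [v] to be the shortest element of [W_J v]: otherwise the first letter
    of the [W_J]-component of [v] would shorten [v]. *)
Lemma lreduced_add J (v : W) x : lreduced J v -> parabolic J x ->
  l (x * v) = (l x + l v)%N.
Proof.
move=> vJ; have [y [v0 [Jy vE min]]] := min_coset J v.
suff -> : v = v0 by exact: min_coset_add.
rewrite vE; suff -> : y = 1 by rewrite mul1g.
have [u [uJ uy su]] := parabolic_reduced Jy.
case: u uJ uy su => [_|s u uJ uy su]; first by rewrite word_prod_nil.
have sJ : s \in J by apply: uJ; rewrite mem_head.
move: uy; rewrite word_prod_cons => uy.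
have syE : g s * y = wd u by rewrite -uy cox_genK.
have := vJ s sJ; rewrite vE mulgA !(min_coset_add min)//; last first.
  by apply: parabolicM => //; apply: parabolic_gen.
by rewrite syE; have := cox_length_word u; move: su => /=; len_lia.
Qed.

Lemma rreduced_lreduced J w : rreduced J w <-> lreduced J w^-1.
Proof.
have e s : l (g s * w^-1) = l (w * g s).
  by rewrite -cox_lengthV invgM invgK cox_genV.
by split=> H s sJ; have := H s sJ; rewrite cox_lengthV ?e // -e.
Qed.

Lemma rreduced_add J w x : rreduced J w -> parabolic J x ->
  l (w * x) = (l w + l x)%N.
Proof.
move=> /rreduced_lreduced wJ Jx.
rewrite -cox_lengthV invgM (lreduced_add wJ) ?cox_lengthV ?(addnC (l x))//.
exact: parabolicV.
Qed.

End CoxeterGroups.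

(** * Weak order and minimal coset representatives *)

Section WeakOrder.
Variable W : coxeter_system.
Local Notation S := (cox_type W).
Local Notation g := (@cox_gen W).
Local Notation l := (@cox_length W).
Local Notation wd := (word_prod g).
Implicit Types (s r t : S) (u v : seq S) (w x y z a b c d m : W) (J K L : {set S}).

(** The right weak order: some reduced word of [b] begins with a reduced word of [a]. *)
Definition wle a b : Prop := l b = (l a + l (a^-1 * b))%N.

Lemma wle1 a : wle 1 a.
Proof. by rewrite /wle cox_length1 invg1 mul1g. Qed.

Lemma wle_trans b a c : wle a b -> wle b c -> wle a c.
Proof.
rewrite /wle => ab bc.
have := cox_lengthM a (a^-1 * c); have := cox_lengthM (a^-1 * b) (b^-1 * c).
by gsimp; len_lia.
Qed.

Lemma wle_anti a b : wle a b -> wle b a -> a = b.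
Proof.
rewrite /wle => ab ba.
have /cox_length_eq0/mulg1_eq : l (a^-1 * b) = 0%N by len_lia.
by rewrite invgK.
Qed.

Lemma wle_length a b : wle a b -> (l a <= l b)%N.
Proof. by rewrite /wle => ->; exact: leq_addr. Qed.

Lemma wleM a x : l (a * x) = (l a + l x)%N -> wle a (a * x).
Proof. by rewrite /wle mulKg. Qed.

Lemma wle_gen s w : wle (g s) w <-> l w = (l (g s * w)).+1.
Proof. by rewrite /wle cox_length_gen cox_genV. Qed.

Lemma wle_add x a b : wle a b -> l (x * b) = (l x + l b)%N ->
  l (x * a) = (l x + l a)%N.
Proof.
rewrite /wle => ab xb; have := cox_lengthM x a.
have := cox_lengthM (x * a) (a^-1 * b).
by gsimp; len_lia.
Qed.

Lemma wle_mull x a b : l (x * a) = (l x + l a)%N ->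
  l (x * b) = (l x + l b)%N -> wle (x * a) (x * b) <-> wle a b.
Proof.
rewrite /wle => -> ->; rewrite (_ : (x * a)^-1 * (x * b) = a^-1 * b).
  by split; len_lia.
by gsimp.
Qed.

Lemma wle_first a : a <> 1 -> exists s, wle (g s) a.
Proof.
have [[|s u] ua su] := reduced_word a; first by case; rewrite -ua word_prod_nil.
move=> _; exists s; apply/wle_gen; rewrite -su -ua word_prod_cons cox_genK /=.
have := cox_length_word u; have := cox_length_mulgen s (wd u).
by rewrite -word_prod_cons ua -su /=; len_lia.
Qed.

(** * Rank two parabolic subgroups and meets in the weak order *)

Fixpoint alternating s r n : seq S :=
  if n is n'.+1 then s :: alternating r s n' else [::].

Lemma size_alternating s r n : size (alternating s r n) = n.
Proof. by elim: n s r => //= n IH s r; rewrite IH. Qed.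

Lemma sub_alternating s r n : {subset alternating s r n <= [:: s; r]}.
Proof.
elim: n s r => //= n IH s r t; rewrite inE => /orP[/eqP->|/IH].
  by rewrite mem_head.
by rewrite !inE orbC.
Qed.

Lemma take_alternating s r (n k : nat) : (n <= k)%N ->
  take n (alternating s r k) = alternating s r n.
Proof. by elim: n k s r => [|n IH] [|k] s r //= nk; rewrite IH. Qed.

Lemma alternating_rcons s r n :
  alternating s r n.+1 = rcons (alternating s r n) (if odd n then r else s).
Proof.
elim: n s r => // n IH s r.
have -> : alternating s r n.+2 = s :: alternating r s n.+1 by [].
by rewrite IH /=; case: (odd n).
Qed.

Lemma reduced_alternating s r u : {subset u <= [:: s; r]} ->
  size u = l (wd u) -> head s u = s -> u = alternating s r (size u).
Proof.
elim: u s r => [//|a u IH] s r /= sub su e; rewrite e in sub su *.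
congr (_ :: _); have lu : size u = l (wd u).
  move: su; rewrite word_prod_cons.
  by have := cox_length_word u; have := cox_length_mulgen s (wd u); len_lia.
apply: IH => //.
  move=> t tu; have /sub : t \in s :: u by rewrite inE tu orbT.
  by rewrite !inE orbC.
case: u sub su lu => [//|b u] sub su _ /=.
have : b \in [:: s; r] by apply: sub; rewrite !inE eqxx orbT.
rewrite !inE => /orP[/eqP bs|/eqP//]; move: su.
rewrite bs !word_prod_cons cox_genK => e'.
by have := cox_length_word u; rewrite -e' /=; len_lia.
Qed.

Lemma dihedral_word s r x : parabolic [set s; r]%SET x -> wle (g s) x ->
  x = wd (alternating s r (l x)).
Proof.
move=> Jx /wle_gen sx; have sJ : s \in [set s; r]%SET by rewrite !inE eqxx.
have [u [uJ ux su]] := parabolic_reduced (parabolicM (parabolic_gen sJ) Jx).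
have suE : wd (s :: u) = x by rewrite word_prod_cons ux cox_genK.
have lx : l x = size (s :: u) by rewrite sx /= su.
rewrite lx -(@reduced_alternating s r (s :: u)) ?suE//.
move=> t; rewrite inE => /orP[/eqP->|/uJ]; first by rewrite mem_head.
by rewrite !inE.
Qed.

(* Such an x has two reduced words, alternating in s and r, with distinct last
   letters; hence it has no reduced continuation by s or r. *)
Lemma dihedral_longest s r x y : s <> r ->
  parabolic [set s; r]%SET x -> parabolic [set s; r]%SET y ->
  wle (g s) x -> wle (g r) x -> wle (g s) y -> wle (g r) y -> x = y.
Proof.
move=> sr; have aux z w : parabolic [set s; r]%SET z ->
    parabolic [set s; r]%SET w -> wle (g s) z -> wle (g r) z -> wle (g s) w ->
    (l z < l w)%N -> False.
  move=> Jz Jw sz rz sw zw.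
  have zE := dihedral_word Jz sz; have wE := dihedral_word Jw sw.
  have zE' : z = wd (alternating r s (l z)).
    by apply: dihedral_word => //; rewrite finset.setUC.
  have [n nz] : exists n, l z = n.+1.
    by case: (l z) (wle_length sz) => [|n]; [rewrite cox_length_gen|exists n].
  have desc q : q \in [:: s; r] -> (l (z * g q) < l z)%N.
    have K t t' : z = wd (alternating t t' n.+1) ->
        (l (z * g (if odd n then t' else t)) < n.+1)%N.
      move=> ->; rewrite alternating_rcons -cats1 word_prod_cat.
      rewrite word_prod_cons word_prod_nil mulg1 cox_genKr ltnS.
      by rewrite -[leqRHS](size_alternating t t') cox_length_word.
    rewrite nz in zE zE' *; have := K _ _ zE; have := K _ _ zE'.
    by rewrite !inE; case: odd => H H' /orP[] /eqP->.
  have := size_alternating s r (l w).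
  rewrite -[in X in X = _](cat_take_drop (l z) (alternating s r (l w))).
  rewrite take_alternating ?(ltnW zw)// size_cat size_alternating.
  case E: (drop _ _) => [|q v] /=; first by len_lia.
  move=> sv; have q2 : q \in [:: s; r].
    by apply: (@sub_alternating s r (l w)); apply: (@mem_drop (l z)); rewrite E mem_head.
  have : w = z * g q * wd v.
    rewrite {1}wE -(cat_take_drop (l z) (alternating s r (l w))) E.
    by rewrite take_alternating ?(ltnW zw)// word_prod_cat -zE word_prod_cons mulgA.
  move=> wE'; have := cox_lengthM (z * g q) (wd v); rewrite -wE'.
  by have := desc q q2; have := cox_length_word v; len_lia.
move=> Jx Jy sx rx sy ry; have [lt|gt|e] := ltngtP (l x) (l y).
- by case: (aux x y).
- by case: (aux y x).
by rewrite (dihedral_word Jx sx) (dihedral_word Jy sy) e.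
Qed.

Lemma dihedral_part s r x : wle (g s) x -> wle (g r) x ->
  exists z, [/\ parabolic [set s; r]%SET z, wle (g s) z, wle (g r) z & wle z x].
Proof.
move=> sx rx; have [z [v [Jz xE min]]] := min_coset [set s; r]%SET x.
have add := min_coset_add min; exists z; split=> //; last first.
- by rewrite xE; apply: wleM; exact: add.
- apply/wle_gen; move/wle_gen: rx; rewrite xE mulgA !add//.
    by len_lia.
  by apply: parabolicM => //; apply: parabolic_gen; rewrite !inE eqxx orbT.
apply/wle_gen; move/wle_gen: sx; rewrite xE mulgA !add//.
  by len_lia.
by apply: parabolicM => //; apply: parabolic_gen; rewrite !inE eqxx.
Qed.

Definition is_meet x y m : Prop :=
  [/\ wle m x, wle m y & forall c, wle c x -> wle c y -> wle c m].

Lemma wle_genl s a x : wle (g s) a -> wle (g s) x ->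
  wle a x <-> wle (g s * a) (g s * x).
Proof.
move=> /wle_gen sa /wle_gen sx.
rewrite -{1}(cox_genK s a) -{1}(cox_genK s x); apply: wle_mull.
  by rewrite cox_genK cox_length_gen add1n.
by rewrite cox_genK cox_length_gen add1n.
Qed.

(** Induction on the length of [x]. For a common first letter [s], the meet of [s x] and [s y],
    multiplied by [s], is greatest among the common lower bounds that begin with [s]; lower bounds
    beginning with another letter [r] are compared in rank two. *)
Lemma meet_ex x y : exists m, is_meet x y m.
Proof.
have [n] := ubnP (l x); elim: n x y => [//|n IH] x y; rewrite ltnS => xn.
have key s : wle (g s) x -> wle (g s) y -> exists m, [/\ wle m x, wle m y,
    wle (g s) m & forall c, wle (g s) c -> wle c x -> wle c y -> wle c m].
  move=> sx sy; have /wle_gen lsx := sx.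
  have [|m [mx my mm]] := IH (g s * x) (g s * y); first by rewrite -lsx.
  have sm : wle (g s) (g s * m).
    apply: wleM; apply: wle_add mx _.
    by rewrite cox_genK cox_length_gen add1n.
  exists (g s * m); split=> //.
  - by apply/(wle_genl sm sx); rewrite cox_genK.
  - by apply/(wle_genl sm sy); rewrite cox_genK.
  move=> c sc cx cy; apply/(wle_genl sc sm); rewrite cox_genK; apply: mm.
    exact: (iffLR (wle_genl sc sx)).
  exact: (iffLR (wle_genl sc sy)).
have [[s [sx sy]]|no] := pselect (exists s, wle (g s) x /\ wle (g s) y); last first.
  exists 1; split=> [||c cx cy]; try exact: wle1.
  have [->|/wle_first[s sc]] := pselect (c = 1); first exact: wle1.
  by case: no; exists s; split; apply: wle_trans sc _.
have [m [mx my sm mm]] := key s sx sy; exists m; split=> // c cx cy.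
have [->|/wle_first[r rc]] := pselect (c = 1); first exact: wle1.
have rx := wle_trans rc cx; have ry := wle_trans rc cy.
have [m' [m'x m'y rm' mm']] := key r rx ry.
apply: wle_trans (mm' c rc cx cy) _; apply: mm => //.
have [->//|sr] := pselect (s = r).
(* The longest element [d] of the parabolic subgroup of [s] and [r] is below both [x] and [y]. It
   begins with [r], hence is below [m']; so [m'] begins with [s] and is below [m]. *)
have [d [Jd sd rd dx]] := dihedral_part sx rx.
have [d' [Jd' sd' rd' dy]] := dihedral_part sy ry.
have dd' := dihedral_longest sr Jd Jd' sd rd sd' rd'; rewrite -dd' in dy.
by apply: wle_trans sd _; exact: mm'.
Qed.

Lemma meet_mull a x y m : wle a x -> wle a y -> is_meet x y m ->
  wle a m /\ is_meet (a^-1 * x) (a^-1 * y) (a^-1 * m).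
Proof.
move=> ax ay [mx my mm]; have am := mm a ax ay; split=> //.
have add z : wle a z -> l (a * (a^-1 * z)) = (l a + l (a^-1 * z))%N.
  by rewrite mulVKg.
split.
- by apply/(wle_mull (add _ am) (add _ ax)); rewrite !mulVKg.
- by apply/(wle_mull (add _ am) (add _ ay)); rewrite !mulVKg.
move=> c cx cy; have ac := wle_add cx (add _ ax).
apply/(wle_mull ac (add _ am)); rewrite mulVKg; apply: mm.
  by move/(wle_mull ac (add _ ax)): cx; rewrite mulVKg.
by move/(wle_mull ac (add _ ay)): cy; rewrite mulVKg.
Qed.

Lemma least_of_meet_closed (P : set W) b : P b ->
  (forall x y m, P x -> P y -> is_meet x y m -> P m) ->
  exists2 b0, P b0 & forall c, P c -> wle b0 c.
Proof.
move=> Pb PM; pose Q n := `[< exists2 c, P c & l c = n >].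
have exQ : exists n, Q n by exists (l b); apply/asboolP; exists b.
case: (ex_minnP exQ) => n /asboolP[b0 Pb0 b0n] min; exists b0 => // c Pc.
have [m mE] := meet_ex b0 c; have Pm := PM _ _ _ Pb0 Pc mE.
have [mb mc _] := mE.
have nm : (n <= l m)%N by apply: min; apply/asboolP; exists m.
suff <- : m = b0 by [].
apply: wle_anti => //; rewrite /wle.
have b0m : l (m^-1 * b0) = 0%N by move: mb; rewrite /wle b0n; len_lia.
by have /mulg1_eq := cox_length_eq0 b0m; rewrite invgK => ->; rewrite mulVg cox_length1 addn0.
Qed.

(** [b] is the shortest element of [W_K b] and conjugates [K] into [S]. *)
Definition transports K b : Prop :=
  forall s, s \in K -> l (g s * b) = (l b).+1 /\ exists t, g s * b = b * g t.

(* Left translation by s preserves meets of elements lengthened by s, and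
   x is below s x when s x = x t; hence m is below s m as well. *)
Lemma transports_meet K x y m : transports K x -> transports K y ->
  is_meet x y m -> transports K m.
Proof.
move=> Kx Ky [mx my mm] s sK.
have [lx [t xt]] := Kx s sK; have [ly [t' yt]] := Ky s sK.
have add z : l (g s * z) = (l z).+1 -> l (g s * z) = (l (g s) + l z)%N.
  by move=> ->; rewrite cox_length_gen add1n.
have lm : l (g s * m) = (l m).+1.
  by have := wle_add mx (add _ lx); rewrite cox_length_gen add1n.
split=> //.
have xsx : wle x (g s * x) by rewrite xt; apply: wleM; rewrite -xt lx cox_length_gen addn1.
have ysy : wle y (g s * y) by rewrite yt; apply: wleM; rewrite -yt ly cox_length_gen addn1.
have sx := wleM (add _ lx); have sy := wleM (add _ ly); have sm := wleM (add _ lm).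
have [n [nx ny nn]] := meet_ex (g s * x) (g s * y).
have sn := nn _ sx sy.
have mn : wle m n by apply: nn; [exact: wle_trans xsx|exact: wle_trans ysy].
have nm : wle n (g s * m).
  apply/(wle_genl sn sm); rewrite cox_genK; apply: mm.
    by move/(wle_genl sn sx): nx; rewrite cox_genK.
  by move/(wle_genl sn sy): ny; rewrite cox_genK.
have := wle_trans mn nm; rewrite /wle lm => e.
have [|t'' e'] := @cox_length_eq1 W (m^-1 * (g s * m)); first by len_lia.
by exists t''; rewrite -e' mulVKg.
Qed.

(** * Shortest coset representatives and stabilizers of cosets *)

Lemma exchange_cat s u v : (l (g s * wd (u ++ v)) < l (wd (u ++ v)))%N ->
  (exists2 u', (size u' < size u)%N & g s * wd u = wd u') \/
  (exists v', [/\ {subset v' <= v}, (size v' < size v)%N &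
     g s * wd (u ++ v) = wd (u ++ v')]).
Proof.
move=> /exchange[u1 [t [u2 [e E]]]].
have [lt|ge] := ltnP (size u1) (size u); [left|right].
  have eu : u = u1 ++ t :: take (size u - size u1).-1 u2.
    have := congr1 (take (size u)) e; rewrite take_size_cat// take_cat.
    by rewrite ltnNge (ltnW lt)/=; case: (size u - size u1)%N (subn_gt0 (size u1) (size u)) => [|k]; rewrite ?lt.
  exists (u1 ++ take (size u - size u1).-1 u2).
    by rewrite [in X in (_ < X)%N]eu !size_cat /=; len_lia.
  have ev : u2 = take (size u - size u1).-1 u2 ++ v.
    move: e; rewrite {1}eu -catA => /eqP; rewrite eqseq_cat// eqxx /= eqseq_cons eqxx /=.
    by move=> /eqP.
  by move: E; rewrite {1}ev catA !word_prod_cat !mulgA => /mulIg.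
have eu : u1 = u ++ drop (size u) u1.
  have := congr1 (take (size u)) e; rewrite take_size_cat// takel_cat// => {1}->.
  by rewrite cat_take_drop.
have ev : v = drop (size u) u1 ++ t :: u2.
  by move: e; rewrite {1}eu -catA => /eqP; rewrite eqseq_cat// eqxx /= => /eqP.
exists (drop (size u) u1 ++ u2); split.
- by move=> q; rewrite [in X in _ -> X]ev !mem_cat inE => /orP[]->; rewrite ?orbT.
- by rewrite [in X in (_ < X)%N]ev !size_cat /=; len_lia.
by rewrite E {1}eu -catA.
Qed.

Lemma rreduced_eq J x y : rreduced J x -> rreduced J y ->
  parabolic J (x^-1 * y) -> x = y.
Proof.
move=> xJ yJ Jxy; have := rreduced_add xJ Jxy.
have := rreduced_add yJ (parabolicV Jxy); rewrite invgM invgK !mulVKg.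
have := cox_lengthV (x^-1 * y); rewrite invgM invgK => -> e e'.
have /cox_length_eq0/mulg1_eq : l (x^-1 * y) = 0%N by len_lia.
by rewrite invgK.
Qed.

Lemma mrep_ex J x : exists w, parabolic J (w^-1 * x) /\ rreduced J w.
Proof.
have [y [w [Jy e min]]] := min_coset J x^-1; exists w^-1; split.
  by rewrite invgK -[x]invgK e invgM mulVKg; exact: parabolicV.
apply/rreduced_lreduced; rewrite invgK => s sJ.
by rewrite (min_coset_add min) ?cox_length_gen//; exact: parabolic_gen.
Qed.

(* The element of minimal length of the coset x W_J. *)
Definition mrep J x : W := sval (cid (mrep_ex J x)).

Lemma mrep_parabolic J x : parabolic J ((mrep J x)^-1 * x).
Proof. by rewrite /mrep; case: cid => w []. Qed.

Lemma mrep_rreduced J x : rreduced J (mrep J x).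
Proof. by rewrite /mrep; case: cid => w []. Qed.

Lemma mrepE J w x : rreduced J w -> parabolic J (w^-1 * x) -> mrep J x = w.
Proof.
move=> wJ Jwx; apply: (@rreduced_eq J) => //; first exact: mrep_rreduced.
have := parabolicM (@mrep_parabolic J x) (parabolicV Jwx); gsimp.
by [].
Qed.

Lemma mrep_eq J x y : parabolic J (x^-1 * y) -> mrep J x = mrep J y.
Proof.
move=> Jxy; apply: mrepE; first exact: mrep_rreduced.
by have := parabolicM (@mrep_parabolic J y) (parabolicV Jxy); gsimp.
Qed.

(** The generators whose left multiplication stabilizes the coset [w W_J]. *)
Definition flat_type J w : {set S} :=
  [set s | `[< parabolic J (w^-1 * g s * w) >]]%SET.

Lemma flat_typeP J w s : s \in flat_type J w <-> parabolic J (w^-1 * g s * w).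
Proof. by rewrite inE; split => /asboolP. Qed.

Lemma flat_type_parabolic J w x : parabolic (flat_type J w) x -> parabolic J (w^-1 * x * w).
Proof.
move: x; apply: parabolic_ind; first by gsimp; exact: parabolic1.
move=> s x /flat_typeP Js _ _ Jx; have := parabolicM Js Jx; gsimp.
by [].
Qed.

Lemma flat_type_gen J w s : rreduced J w -> s \in flat_type J w ->
  l (g s * w) = (l w).+1 /\ exists t, g s * w = w * g t.
Proof.
move=> wJ /flat_typeP Js; have := rreduced_add wJ Js.
rewrite !mulgA mulgV mul1g => e.
have lt : l (w^-1 * g s * w) <> 0%N.
  move/cox_length_eq0 => e1; have : g s * w = w.
    by rewrite -[RHS]mulg1 -e1 !mulgA mulgV mul1g.
  by move=> e2; have := cox_length_mulgen s w; rewrite e2; len_lia.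
have [lw|lw] := cox_length_mulgen s w; last by len_lia.
split=> //; have [|t te] := @cox_length_eq1 W (w^-1 * g s * w); first by len_lia.
by exists t; rewrite -te !mulgA mulgV mul1g.
Qed.

(** If [t] in [J] shortened [s w], then [s] would shorten [w t]. The exchange condition deletes a
    letter of [w], which the lengths exclude, or the final [t], which gives [s w = w t] and makes
    [s] stabilize [w W_J]. *)
Lemma deodhar J w s : rreduced J w -> s \notin flat_type J w -> rreduced J (g s * w).
Proof.
move=> wJ /negP sf t tJ; have wt := wJ t tJ.
have [//|sw] := cox_length_mulgenr t (g s * w).
case: sf; have [u uw su] := reduced_word w.
have wdt : wd [:: t] = g t by rewrite word_prod_cons word_prod_nil mulg1.
have [|[u' u'u e]|[v' [_ v1 e]]] := @exchange_cat s u [:: t].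
- rewrite word_prod_cat uw wdt mulgA wt.
  by have := cox_length_mulgen s w; len_lia.
- have := cox_length_word u'; rewrite -e uw.
  have := cox_length_mulgen s w; have := cox_length_mulgen s (w * g t).
  by rewrite mulgA; len_lia.
move: e; case: v' v1 => // _; rewrite cats0 word_prod_cat uw wdt => e.
have e' : g s * w = w * g t by rewrite -{2}e mulgA cox_genKr.
by apply/flat_typeP; rewrite -mulgA e' mulKg; exact: parabolic_gen.
Qed.

Lemma mrep_gen_fix J x s : s \in flat_type J (mrep J x) ->
  mrep J (g s * x) = mrep J x.
Proof.
move=> /flat_typeP Js; apply: mrepE; first exact: mrep_rreduced.
have := parabolicM Js (@mrep_parabolic J x); gsimp.
by [].
Qed.

Lemma mrep_gen_move J x s : s \notin flat_type J (mrep J x) ->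
  mrep J (g s * x) = g s * mrep J x.
Proof.
move=> sf; apply: mrepE; first exact: deodhar (@mrep_rreduced _ _) sf.
by rewrite invgM -mulgA mulKg; exact: mrep_parabolic.
Qed.

(** The intersection of [W_L] with the conjugate of [W_J] by [w] is a standard parabolic subgroup.
    Write [s x w = w v] with [v] in [W_J]: as [w] is shortest in [W_L w], exchanging [s] deletes a
    letter of [v], so [s] itself lies in the conjugate and can be stripped off. *)
Lemma kilmoyer J L w x : lreduced L w -> rreduced J w -> parabolic L x ->
  parabolic J (w^-1 * x * w) -> parabolic (flat_type J w :&: L)%SET x.
Proof.
move=> wL wJ; move: x; apply: parabolic_ind => [_|s x sL Lx sx IH Jsx].
  exact: parabolic1.
have sf : s \in flat_type J w; last first.
  apply: parabolicM; first by apply: parabolic_gen; rewrite inE sf.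
  apply: IH; have /flat_typeP Js := sf.
  by have := parabolicM (parabolicV Js) Jsx; gsimp.
have [u uw su] := reduced_word w.
have [v [vJ vE sv]] := parabolic_reduced Jsx.
have uvE : wd (u ++ v) = g s * x * w.
  by rewrite word_prod_cat uw vE !mulgA mulgV mul1g.
have Lsx : parabolic L (g s * x) by apply: parabolicM => //; exact: parabolic_gen.
have [|[u' u'u e]|[v' [v'v _ e]]] := @exchange_cat s u v.
- rewrite uvE (lreduced_add wL Lsx) -!mulgA cox_genK (lreduced_add wL Lx) sx.
  exact: leqnn.
- have := cox_length_word u'; rewrite -e uw (wL s sL); len_lia.
apply/flat_typeP; have Jv' : parabolic J (wd v') by apply: parabolic_word => t /v'v/vJ.
suff -> : w^-1 * g s * w = wd v' * (w^-1 * (g s * x) * w)^-1.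
  by apply: parabolicM => //; apply: parabolicV.
rewrite -vE; apply: (mulIg (wd v)); rewrite mulgVK; apply: (mulgI w).
by rewrite !mulgA mulgV mul1g -(mulgA _ w) -uw -!word_prod_cat.
Qed.

End WeakOrder.

(** * Galleries, gates and projections in a building *)

Section BuildingGeometry.
Variables (W : coxeter_system) (X : building W).
Local Notation S := (cox_type W).
Local Notation g := (@cox_gen W).
Local Notation l := (@cox_length W).
Local Notation wd := (word_prod g).
Implicit Types (s t : S) (u v : seq S) (a b w x : W) (J K L : {set S}).
Implicit Types (C D E y z : X).

Lemma delta_self C : delta C C = 1.
Proof. exact/delta_eq1. Qed.

Lemma delta_gen_sym C D s : delta C D = g s -> delta D C = g s.
Proof.
move=> CD; have := delta_adj C CD; rewrite delta_self => -[e|/esym/delta_eq1 DC].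
  by apply: (mulgI (g s)); rewrite -e cox_gen_sq.
by rewrite DC in CD *.
Qed.

Fixpoint chain u C D : Prop :=
  if u is s :: u' then exists2 C', delta C C' = g s & chain u' C' D else C = D.

Lemma chain_ex u C D : delta C D = wd u -> chain u C D.
Proof.
elim: u C => [|s u IH] C; first by rewrite word_prod_nil => /delta_eq1.
rewrite word_prod_cons => e; have [C' C'C C'D] := delta_ex s C D.
exists C'; first exact: delta_gen_sym.
by apply: IH; rewrite C'D e cox_genK.
Qed.

Lemma chain_cat u v C D E : chain u C D -> chain v D E -> chain (u ++ v) C E.
Proof.
elim: u C => [|s u IH] C /=; first by move=> ->.
by move=> [C' CC' ch] vE; exists C' => //; exact: IH.
Qed.

Lemma chain_rev u C D : chain u C D -> chain (rev u) D C.
Proof.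
elim: u C => [|s u IH] C /=; first by move=> ->.
move=> [C' /delta_gen_sym CC' /IH ch]; rewrite rev_cons -cats1.
by apply: chain_cat ch _; exists C.
Qed.

Lemma chain_reduced u C D : size u = l (wd u) -> chain u C D ->
  delta C D = wd u.
Proof.
elim: u C => [|s u IH] C; first by rewrite word_prod_nil => _ /= ->; exact: delta_self.
rewrite word_prod_cons => su [C' CC' ch].
have lu : size u = l (wd u).
  by move: su => /=; have := cox_length_word u; have := cox_length_mulgen s (wd u); len_lia.
have C'D := IH _ lu ch.
by rewrite -C'D; apply: delta_adj_len CC' _; rewrite C'D -su -lu.
Qed.

Lemma deltaV C D : delta D C = (delta C D)^-1.
Proof.
have [u uE su] := reduced_word (delta C D).
rewrite -uE -word_prod_rev; apply: chain_reduced.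
  by rewrite word_prod_rev cox_lengthV uE size_rev.
by apply: chain_rev; apply: chain_ex.
Qed.

Lemma delta_comp C D E :
  l (delta C D * delta D E) = (l (delta C D) + l (delta D E))%N ->
  delta C E = delta C D * delta D E.
Proof.
have [u uE su] := reduced_word (delta C D).
have [v vE sv] := reduced_word (delta D E).
rewrite -uE -vE -word_prod_cat => e; apply: chain_reduced.
  by rewrite e size_cat su sv uE vE.
by apply: (@chain_cat _ _ _ D); apply: chain_ex.
Qed.

Lemma delta_step C E a : exists2 D, delta C D = a & delta D E = a^-1 * delta C E.
Proof.
have [u <- su] := reduced_word a; rewrite -/(wd u).
suff [D ch DE] : exists2 D, chain u C D & delta D E = (wd u)^-1 * delta C E.
  by exists D => //; apply: chain_reduced => //; rewrite su.
elim: u C {su} => [|s u IH] C.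
  by exists C => //; rewrite word_prod_nil invg1 mul1g.
have [C' C'C C'E] := delta_ex s C E; have [D ch DE] := IH C'.
exists D; first by exists C' => //; exact: delta_gen_sym.
by rewrite DE C'E word_prod_cons invgM cox_genV mulgA.
Qed.

(** Along a gallery from [C] to [D] each step either multiplies the distance to [E] by its letter or
    leaves it unchanged; [u'] keeps the letters of the first kind. *)
Lemma delta_subword u C D E : delta C D = wd u ->
  exists2 u', subseq u' u & delta D E = (wd u')^-1 * delta C E.
Proof.
elim: u C => [|s u IH] C.
  rewrite word_prod_nil => /delta_eq1 ->; exists [::] => //.
  by rewrite word_prod_nil invg1 mul1g.
move=> e; have [C' C'C C'D] := delta_ex s C D.
have [|u' u'u DE] := IH C'; first by rewrite C'D e word_prod_cons cox_genK.
have [C'E|C'E] := delta_adj E C'C; rewrite C'E in DE.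
  exists (s :: u'); first by rewrite /= eqxx.
  by rewrite DE word_prod_cons invgM cox_genV mulgA.
exists u' => //; exact: subseq_trans (subseq_cons _ _).
Qed.

Lemma delta_parabolic J C D E : parabolic J (delta C D) ->
  exists2 x, parabolic J x & delta D E = x * delta C E.
Proof.
move=> /parabolic_reduced[u [uJ uE _]].
have [u' u'u ->] := delta_subword E (esym uE).
exists (wd u')^-1 => //; apply: parabolicV; apply: parabolic_word.
by move=> s /(mem_subseq u'u)/uJ.
Qed.

Lemma delta_parabolicr J C D E : parabolic J (delta D E) ->
  parabolic J ((delta C D)^-1 * delta C E).
Proof.
move=> JDE; have [x Jx] := delta_parabolic C JDE.
rewrite (deltaV C E) (deltaV C D) => /(congr1 (fun x => x^-1)).
by rewrite invgM !invgK => ->; rewrite mulKg; exact: parabolicV.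
Qed.

Lemma panel_adj s C D E : delta D C = g s -> delta E C = g s ->
  D = E \/ delta D E = g s.
Proof.
move=> DC /delta_gen_sym CE; have [|] := delta_adj E DC; rewrite CE.
  by rewrite cox_gen_sq => /delta_eq1; left.
by right.
Qed.

(** The first steps from [C] towards [y] and towards [z] lie in one [s]-panel and are at the same
    distance from [D]. Since [s] lengthens that distance, [s]-adjacent chambers could not share it,
    so these steps coincide. *)
Lemma unique_midpoint C D y z a : delta C y = a -> delta C z = a ->
  delta y D = delta z D -> l (a * delta y D) = (l a + l (delta y D))%N -> y = z.
Proof.
have [u <- su] := reduced_word a; move=> Cy Cz yz; rewrite -su.
elim: u C su Cy Cz => [|s u IH] C.
  by rewrite word_prod_nil => _ /delta_eq1<- /delta_eq1.
rewrite word_prod_cons => su Cy Cz; rewrite -mulgA => add.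
have lu : size u = l (wd u).
  by move: su => /=; have := cox_length_word u; have := cox_length_mulgen s (wd u); len_lia.
have [C1 C1C C1y] := delta_ex s C y; have [C2 C2C C2z] := delta_ex s C z.
rewrite Cy cox_genK in C1y; rewrite Cz cox_genK in C2z.
have addu : l (wd u * delta y D) = (size u + l (delta y D))%N.
  move: add su => /=; have := cox_length_mulgen s (wd u * delta y D).
  have := cox_lengthM (wd u) (delta y D); rewrite lu; len_lia.
have C1D : delta C1 D = wd u * delta y D.
  by rewrite -C1y; apply: delta_comp; rewrite C1y addu lu.
have C2D : delta C2 D = wd u * delta y D.
  by rewrite yz -C2z; apply: delta_comp; rewrite C2z -yz addu lu.
have [e|C12] := panel_adj C1C C2C.
  by apply: (IH C1) => //; rewrite e.
have := delta_adj_len C12; move=> /(_ D); rewrite C2D C1D add addu => /(_ erefl).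
move=> e; have := congr1 l e; rewrite add addu /=; len_lia.
Qed.

Lemma delta_path C p : path (@Defs.adjacent W X) C p ->
  (l (delta C (last C p)) <= size p)%N.
Proof.
elim: p C => [|D p IH] C /=; first by rewrite delta_self cox_length1.
move=> /andP[/existsP[s /eqP CD] /IH]; have := delta_adj (last D p) CD.
case=> ->; last by move=> /leqW.
by have := cox_length_mulgen s (delta D (last D p)); len_lia.
Qed.

Lemma gallery_distE C D : gallery_dist C D = l (delta C D).
Proof.
rewrite /gallery_dist; case: ex_minnP => n /asboolP[p [pn pp pl]] min.
apply/eqP; rewrite eqn_leq; apply/andP; split; last first.
  by rewrite -pn -pl; exact: delta_path.
apply: min; apply/asboolP; have [u uE <-] := reduced_word (delta C D).
have := chain_ex (esym uE).
elim: u C {uE p pn pp pl} => [|s u IH] C /=; first by exists [::].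
move=> [C' CC' /IH[p [pn pp pl]]]; exists (C' :: p).
by rewrite /= pn pp pl; split=> //; rewrite andbT; apply/existsP; exists s; apply/eqP.
Qed.

(** * Residues, gates and projections between residues *)

Lemma residue_refl J C : residue_of J C C.
Proof. by rewrite /residue_of /= delta_self; exact: parabolic1. Qed.

Lemma residue_sym J C D : residue_of J C D -> residue_of J D C.
Proof. by rewrite /residue_of /= (deltaV C D); exact: parabolicV. Qed.

Lemma residue_trans J C D E :
  residue_of J C D -> residue_of J D E -> residue_of J C E.
Proof.
rewrite /residue_of /= => CD DE; have := delta_parabolicr C DE.
by move=> /(parabolicM CD); rewrite mulVKg.
Qed.

Lemma residue_eq J C D : residue_of J C D -> residue_of J C = residue_of J D.
Proof.
move=> CD; apply/seteqP; split=> E.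
  by move=> CE; apply: residue_trans CE; exact: residue_sym.
exact: residue_trans.
Qed.

Lemma residue_gate L y D :
  exists2 z, residue_of L y z & lreduced L (delta z D).
Proof.
have [z Dz zy] := delta_step D y (mrep L (delta D y)).
exists z.
  by apply: residue_sym; rewrite /residue_of /= zy; exact: mrep_parabolic.
by rewrite deltaV Dz; apply/rreduced_lreduced; exact: mrep_rreduced.
Qed.

Lemma proj_chamberE L y z D : residue_of L y z -> lreduced L (delta z D) ->
  proj_chamber (residue_of L y) D = z.
Proof.
move=> yz zD; have add E : residue_of L y E ->
    l (delta E D) = (l (delta E z) + l (delta z D))%N.
  move=> yE; have Ez : parabolic L (delta E z).
    exact: residue_trans (residue_sym yE) yz.
  by have := lreduced_add zD Ez => e; rewrite (delta_comp e).
have lD E : l (delta D E) = l (delta E D) by rewrite deltaV cox_lengthV.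
apply: xget_unique.
  split=> // E /add; rewrite !gallery_distE !lD => ->; exact: leq_addl.
move=> E [yE /(_ z yz)]; rewrite !gallery_distE !lD (add E yE) => le.
have /cox_length_eq0/delta_eq1 : l (delta E z) = 0%N by len_lia.
by [].
Qed.

(* The gate of y on the residue of type J of C is at distance wpos J C y from y. *)
Definition wpos J C y : W := mrep J (delta y C).

Lemma wpos_gate J C y : exists2 D, residue_of J C D & delta y D = wpos J C y.
Proof.
have [D yD DC] := delta_step y C (wpos J C y); exists D => //.
by apply: residue_sym; rewrite /residue_of /= DC; exact: mrep_parabolic.
Qed.

Lemma wpos_mem J C D y : residue_of J C D -> mrep J (delta y D) = wpos J C y.
Proof. by move=> CD; symmetry; apply: mrep_eq; exact: delta_parabolicr. Qed.

Lemma wpos_flat J C y z : parabolic (flat_type J (wpos J C y)) (delta y z) ->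
  wpos J C z = wpos J C y.
Proof.
move=> /(delta_parabolic C)[x Kx yC]; apply: mrepE; first exact: mrep_rreduced.
rewrite yC; have := parabolicM (flat_type_parabolic Kx) (@mrep_parabolic _ J (delta y C)).
by rewrite -/(wpos J C y); gsimp.
Qed.

Lemma wpos_parabolic L J C y z : parabolic L (delta y z) ->
  exists2 x, parabolic L x & wpos J C z = x * wpos J C y.
Proof.
move=> /(delta_parabolic C)[x Lx]; rewrite /wpos => ->; move: x Lx.
apply: parabolic_ind => [|s x sL Lx _ [p Lp e]].
  by exists 1; rewrite ?mul1g//; exact: parabolic1.
rewrite -mulgA; have [sf|sf] := boolP (s \in flat_type J (mrep J (x * delta y C))).
  by exists p => //; rewrite mrep_gen_fix.
exists (g s * p); first by apply: parabolicM => //; exact: parabolic_gen.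
by rewrite mrep_gen_move// e mulgA.
Qed.

(** A gate [z] of [D] is characterized by letters of [L] lengthening [delta z D], and this passes to
    the prefix [wpos J C z]. Conversely such a [y] is the gate of its own gate on the other
    residue. *)
Lemma proj_image L J C Y :
  proj_chamber (residue_of L Y) @` residue_of J C =
  [set y | residue_of L Y y /\ lreduced L (wpos J C y)].
Proof.
apply/seteqP; split=> [_ [D CD <-]|y [Yy yL]] /=.
  have [z Yz zD] := residue_gate L Y D; rewrite (proj_chamberE Yz zD); split=> //.
  move=> s sL; have := wpos_mem z CD => e.
  have /wleM wz : l (wpos J C z * ((wpos J C z)^-1 * delta z D)) =
     (l (wpos J C z) + l ((wpos J C z)^-1 * delta z D))%N.
    by apply: rreduced_add; rewrite -e; [exact: mrep_rreduced|exact: mrep_parabolic].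
  rewrite mulVKg in wz.
  have := wle_add wz; move=> /(_ (g s)); rewrite cox_length_gen !add1n => H.
  exact: H (zD s sL).
have [D CD yD] := wpos_gate J C y; exists D => //.
by apply: proj_chamberE => //; rewrite yD.
Qed.

(** Two chambers of the image have the same [wpos], since each of these is the shortest element of
    one [W_L]-coset; their mutual distance then stabilizes [w W_J] and [kilmoyer] applies. *)
Lemma proj_image_residue L J C Y y : residue_of L Y y ->
  lreduced L (wpos J C y) ->
  proj_chamber (residue_of L Y) @` residue_of J C =
  residue_of (flat_type J (wpos J C y) :&: L)%SET y.
Proof.
move=> Yy yL; rewrite proj_image (residue_eq Yy); set w := wpos J C y.
have wJ : rreduced J w by exact: mrep_rreduced.
apply/seteqP; split=> [z [yz zL]|z yz] /=; last first.
  have -> : wpos J C z = w.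
    by apply: wpos_flat; apply: parabolicS yz => s; rewrite inE => /andP[].
  by split=> //; apply: parabolicS yz => s; rewrite inE => /andP[].
have [p Lp pE] := wpos_parabolic J C yz.
have wzE : wpos J C z = w.
  have := lreduced_add yL Lp; have := lreduced_add zL (parabolicV Lp).
  rewrite pE mulKg cox_lengthV => e1 e2.
  have /cox_length_eq0-> : l p = 0%N by len_lia.
  by rewrite mul1g.
have [D CD yD] := wpos_gate J C y.
have Lzy : parabolic L (delta z y) by rewrite deltaV; exact: parabolicV.
have zD : delta z D = delta z y * w.
  by rewrite -[w]yD; apply: delta_comp; rewrite yD; exact: (lreduced_add yL Lzy).
rewrite /residue_of /= (deltaV z y); apply: parabolicV; apply: kilmoyer => //.
rewrite -mulgA -zD -{1}wzE -(wpos_mem z CD); exact: mrep_parabolic.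
Qed.

End BuildingGeometry.

(** * Limits of residues along a filter *)

Section LimitsOfResidues.
Variables (W : coxeter_system) (X : building W).
Local Notation S := (cox_type W).
Local Notation g := (@cox_gen W).
Local Notation l := (@cox_length W).
Local Notation wd := (word_prod g).
Implicit Types (s t : S) (a b w x : W) (J K L : {set S}) (c d e y z m : X).

(** A pair [(J, C)] stands for the residue of type [J] of [C]. *)
Variable U : set_system ({set S} * X).
Hypothesis UP : ProperFilter U.
Local Notation pos q y := (wpos q.1 q.2 y).

Hypothesis projU : forall s y, exists E,
  \forall q \near U,
    proj_chamber (residue_of [set s]%SET y) @` residue_of q.1 q.2 = E.

(** Eventually the residues project onto the single chamber [e] of its [s]-panel. *)
Definition pole e s : Prop := \forall q \near U,
  lreduced [set s]%SET (pos q e) /\ s \notin flat_type q.1 (pos q e).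

Lemma residue_setI1 K s y z : delta y z = g s ->
  residue_of (K :&: [set s])%SET y z -> s \in K.
Proof.
move=> yz; rewrite /residue_of /= yz => Ks; apply: contraT => sK.
have := cox_length_gen s; rewrite (@parabolic_set0 _ (g s)) ?cox_length1//.
by apply: parabolicS Ks => t; rewrite !inE => /andP[+ /eqP e]; rewrite e (negPf sK).
Qed.

(** The eventual projection [E] is the whole panel or one chamber. To decide, compare a chamber [e]
    of [E] with an [s]-adjacent [e']: the latter lies in [E] exactly when [s] is flat at [e]. *)
Lemma panel_dichotomy y s :
  (\forall q \near U, s \in flat_type q.1 (pos q y)) \/
  exists2 e, residue_of [set s]%SET y e & pole e s.
Proof.
have [E HE] := projU s y; have [q0 q0E] := filter_ex HE.
have [e ye eq0] : exists2 e, residue_of [set s]%SET y e &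
    lreduced [set s]%SET (pos q0 e).
  have [e] : (proj_chamber (residue_of [set s]%SET y) @` residue_of q0.1 q0.2) !=set0.
    by exists (proj_chamber (residue_of [set s]%SET y) q0.2); exists q0.2 => //; exact: residue_refl.
  by rewrite proj_image => -[]; exists e.
have Ee : E e by rewrite -q0E proj_image.
have [e' e'e _] := delta_ex s e e; have ee' := delta_gen_sym e'e.
have EE q : proj_chamber (residue_of [set s]%SET y) @` residue_of q.1 q.2 = E ->
    lreduced [set s]%SET (pos q e) /\ (E e' <-> s \in flat_type q.1 (pos q e)).
  move=> qE; have qe : lreduced [set s]%SET (pos q e).
    by move: Ee; rewrite -qE proj_image => -[].
  split=> //; rewrite -qE (proj_image_residue ye qe); split.
    exact: residue_setI1.
  move=> sf; rewrite /residue_of /= ee'; apply: parabolic_gen.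
  by rewrite !inE eqxx andbT; move: sf; rewrite inE.
have [Ee'|Ee'] := pselect (E e').
  left; apply: filterS HE => q /EE[_ [/(_ Ee') sf _]].
  suff -> : pos q y = pos q e by [].
  apply: wpos_flat; apply: parabolicS (residue_sym ye) => t.
  by rewrite inE => /eqP->.
right; exists e => //; apply: filterS HE => q /EE[qe [_ H]]; split=> //.
by apply/negP => /H.
Qed.

Lemma pole_other e s z : delta z e = g s -> pole e s ->
  \forall q \near U, pos q z = g s * pos q e /\ l (pos q z) = (l (pos q e)).+1.
Proof.
move=> ze; apply: filterS => q [qe sf].
have se := qe s (finset.set11 s).
suff -> : pos q z = g s * pos q e by [].
have Jx := @mrep_parabolic _ q.1 (delta e q.2).
have wJ := deodhar (@mrep_rreduced _ q.1 (delta e q.2)) sf.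
have := rreduced_add wJ Jx; have := rreduced_add (@mrep_rreduced _ q.1 (delta e q.2)) Jx.
rewrite -mulgA mulVKg => e1 e2; rewrite /wpos (delta_adj_len ze) ?mrep_gen_move//.
by rewrite e2 -/(pos q e) se; move: e1; rewrite -/(pos q e); len_lia.
Qed.

(* c lies on a geodesic from y to the residues converging along U. *)
Definition reach y c : Prop := \forall q \near U,
  pos q y = delta y c * pos q c /\ l (pos q y) = (l (delta y c) + l (pos q c))%N.

Lemma reach_refl y : reach y y.
Proof.
by apply: filterE => q; rewrite delta_self mul1g cox_length1.
Qed.

Lemma reach_wle y c : reach y c -> \forall q \near U, wle (delta y c) (pos q y).
Proof. by apply: filterS => q [e1 e2]; rewrite e1; apply: wleM; rewrite -e1. Qed.

Lemma reach_comp y c d : reach y c -> reach c d ->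
  reach y d /\ delta y d = delta y c * delta c d.
Proof.
move=> yc cd; have yd : delta y d = delta y c * delta c d.
  have [q [[e1 e2] [e3 e4]]] := filter_ex (filterI yc cd).
  apply: delta_comp; have := cox_lengthM (delta y c) (delta c d).
  have := cox_lengthM (delta y c * delta c d) (pos q d).
  by rewrite -mulgA -e3 -e1; len_lia.
split=> //; apply: filterS2 yc cd => q [e1 e2] [e3 e4].
rewrite yd -mulgA -e3; split=> //.
have := cox_lengthM (delta y c) (delta c d).
have := cox_lengthM (delta y c * delta c d) (pos q d).
by rewrite -mulgA -e3 -e1; len_lia.
Qed.

Lemma reach_trans c y d : reach y c -> reach c d -> reach y d.
Proof. by move=> yc cd; have [] := reach_comp yc cd. Qed.

(** For a residue near the limit, the geodesics through [c] and [d] end at the same gate of [y],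
    because [pos q y] is shortest in its coset; then [unique_midpoint] applies. *)
Lemma reach_inj y c d : reach y c -> reach y d -> delta y c = delta y d -> c = d.
Proof.
move=> yc yd cd; have [q [[e1 e2] [e3 e4]]] := filter_ex (filterI yc yd).
have [D qD cD] := wpos_gate q.1 q.2 c; have [D' qD' dD'] := wpos_gate q.1 q.2 d.
have yD : delta y D = pos q y by rewrite e1 -cD; apply: delta_comp; rewrite cD -e1.
have yD' : delta y D' = pos q y by rewrite e3 -dD'; apply: delta_comp; rewrite dD' -e3.
have pcd : pos q c = pos q d by apply: (mulgI (delta y c)); rewrite -e1 cd -e3.
have DD' : D = D'.
  have JDD' : parabolic q.1 (delta D D').
    exact: residue_trans (residue_sym qD) qD'.
  apply/delta_eq1; apply: cox_length_eq0.
  have := rreduced_add (@mrep_rreduced _ q.1 (delta y q.2)) JDD'.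
  rewrite -/(pos q y) => e; have := delta_comp (C := y) (D := D) (E := D').
  rewrite yD e => /(_ erefl) e'; have := congr1 l e'; rewrite e yD'; len_lia.
apply: (@unique_midpoint _ _ y D c d (delta y c)) => //.
  by rewrite cD pcd DD' dD'.
by rewrite cD -e1.
Qed.

(** The first letter [s] of [a] eventually shortens the position of [y], so [s] is not flat at [y]
    and [y] is not the pole of its [s]-panel. Move to that pole and continue with the rest of
    [a]. *)
Lemma reach_ex y a : (\forall q \near U, wle a (pos q y)) ->
  exists2 c, delta y c = a & reach y c.
Proof.
elim/cox_ind: a y => [|s a sa IH] y ay.
  by exists y; [exact: delta_self|exact: reach_refl].
have add : l (g s * a) = (l (g s) + l a)%N by rewrite sa cox_length_gen add1n.
have sy : \forall q \near U, wle (g s) (pos q y).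
  by apply: filterS ay => q; exact: wle_trans (wleM add).
have [sf|[e ye es]] := panel_dichotomy y s.
  have [q [/wle_gen h /flat_type_gen]] := filter_ex (filterI sy sf).
  by move=> /(_ (@mrep_rreduced _ _ _))[h' _]; move: h h'; rewrite /wpos; len_lia.
have [|ysE] := parabolic_set1 ye.
  move=> /delta_eq1 ye1; rewrite -ye1 in es.
  have [q [/wle_gen h [h' _]]] := filter_ex (filterI sy es).
  by have := h' s (finset.set11 s); len_lia.
have ys := pole_other ysE es.
have [|c ec ce] := IH e.
  apply: filterS2 ay ys => q + [e1 e2]; rewrite e1.
  apply: (iffLR (wle_mull add _)).
  by rewrite -e1 e2 cox_length_gen add1n.
have yc : delta y c = g s * a.
  by rewrite -ysE -ec; apply: delta_comp; rewrite ysE ec.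
exists c => //; apply: filterS2 ys ce => q [e1 e2] [e3 e4].
rewrite yc -mulgA -ec -e3 ec; split=> //.
by rewrite e2 e4 sa ec.
Qed.

Lemma reach_between z d b : reach z d -> wle (delta z d) b ->
  (\forall q \near U, wle b (pos q z)) ->
  exists m, [/\ delta d m = (delta z d)^-1 * b, reach d m, delta z m = b & reach z m].
Proof.
move=> zd db bz; have [|m dm dmr] := @reach_ex d ((delta z d)^-1 * b).
  apply: filterS2 zd bz => q [e1 e2].
  rewrite e1 -{1}(mulVKg (delta z d) b); apply: (iffLR (wle_mull _ _)).
    by rewrite mulVKg.
  by rewrite -e1.
have [zm zmE] := reach_comp zd dmr.
by exists m; split=> //; rewrite zmE dm mulVKg.
Qed.

(** * Flats and the successor relation *)

Definition flats y : {set S} :=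
  [set s | `[< \forall q \near U, s \in flat_type q.1 (pos q y) >]]%SET.

(** Each generator is eventually flat or eventually not: if the pole is a neighbour of [y], the
    generator shortens the position of [y], whereas a flat one lengthens it. Finiteness of [S] makes
    this uniform. *)
Lemma near_flat_type y : \forall q \near U, flat_type q.1 (pos q y) = flats y.
Proof.
suff H s : \forall q \near U, (s \in flat_type q.1 (pos q y)) = (s \in flats y).
  apply: filterS (filter_forall _ H) => q qH.
  by apply/setP.
have [sf|[e ye es]] := panel_dichotomy y s.
  apply: filterS (sf) => q ->; symmetry; rewrite inE; exact/asboolP.
have ns : \forall q \near U, s \notin flat_type q.1 (pos q y).
  have [/delta_eq1 eq_ye|ysE] := parabolic_set1 ye.
    by rewrite eq_ye; apply: filterS es => q [].
  apply: filterS (pole_other ysE es) => q [e1 e2]; apply/negP => sf.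
  have [h _] := flat_type_gen (@mrep_rreduced _ _ _) sf.
  by move: h; rewrite -/(pos q y) {1}e1 cox_genK e2; len_lia.
apply: filterS (ns) => q /negPf->; symmetry; apply/negbTE; rewrite inE.
apply/negP => /asboolP sf; have [q' [h]] := filter_ex (filterI sf ns).
by rewrite h.
Qed.

Definition coflat c d : Prop := residue_of (flats c) c d.

Lemma coflat_pos c d : coflat c d -> \forall q \near U, pos q d = pos q c.
Proof.
by move=> cd; apply: filterS (near_flat_type c) => q e; apply: wpos_flat; rewrite e.
Qed.

Lemma coflat_flats c d : coflat c d -> flats d = flats c.
Proof.
move=> /coflat_pos cd.
have [q [[<- <-] ->]] := filter_ex (filterI (filterI (near_flat_type c) (near_flat_type d)) cd).
by [].
Qed.

Lemma coflat_refl c : coflat c c.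
Proof. exact: residue_refl. Qed.

Lemma coflat_sym c d : coflat c d -> coflat d c.
Proof. by move=> cd; rewrite /coflat (coflat_flats cd); exact: residue_sym. Qed.

Lemma coflat_trans d c e : coflat c d -> coflat d e -> coflat c e.
Proof.
by rewrite /coflat => cd; rewrite (coflat_flats cd); exact: residue_trans.
Qed.

Lemma near_transports y : \forall q \near U, transports (flats y) (pos q y).
Proof.
apply: filterS (near_flat_type y) => q <- s sf.
exact: flat_type_gen (@mrep_rreduced _ _ _) sf.
Qed.

(* By prec_flats, the generators on the right-hand side are flat directions at c. *)
Definition prec y c : Prop := reach y c /\
  forall s, s \in flats y -> exists t, g s * delta y c = delta y c * g t.

Lemma prec_transports y c : prec y c -> transports (flats y) (delta y c).
Proof.
move=> [yc H] s sf; split; last exact: H.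
have [q [qy]] := filter_ex (filterI (near_transports y) (reach_wle yc)).
have [h _] := qy s sf; move=> /(@wle_add _ (g s)); rewrite h cox_length_gen !add1n.
exact.
Qed.

Lemma prec_refl y : prec y y.
Proof.
split; first exact: reach_refl.
by move=> s _; exists s; rewrite delta_self mul1g mulg1.
Qed.

Lemma prec_flats y c s t : prec y c -> s \in flats y ->
  g s * delta y c = delta y c * g t -> t \in flats c.
Proof.
move=> [yc _] sf e.
have [q [[<- fy] [e1 _]]] := filter_ex (filterI (filterI (near_flat_type c) (near_flat_type y)) yc).
apply/flat_typeP; move: sf; rewrite -fy => /flat_typeP; rewrite e1.
suff -> : (delta y c * pos q c)^-1 * g s * (delta y c * pos q c) =
  (pos q c)^-1 * g t * pos q c by [].
by rewrite invgM -!mulgA (mulgA (g s)) e -mulgA mulKg.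
Qed.

Lemma prec_trans c y d : prec y c -> prec c d -> prec y d.
Proof.
move=> yc cd; have [yd ydE] := reach_comp yc.1 cd.1; split=> // s sf.
have [t te] := yc.2 s sf; have [t' te'] := cd.2 t (prec_flats yc sf te).
by exists t'; rewrite ydE mulgA te -mulgA te' mulgA.
Qed.

(** [b] is the least element satisfying the conditions for both [d1] and [d2]. The chambers at
    distance [b] from [z] reached through [d1] and through [d2] agree by [reach_inj]. *)
Lemma prec_confluent z d1 d2 : reach z d1 -> reach z d2 ->
  exists2 m, prec d1 m & prec d2 m.
Proof.
move=> zd1 zd2; pose P d b := wle (delta z d) b /\
  transports (flats d) ((delta z d)^-1 * b).
have nearP d : reach z d -> \forall q \near U, P d (pos q z).
  move=> zd; apply: filterS3 zd (reach_wle zd) (near_transports d).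
  by move=> q [e1 e2] h1 h2; split=> //; rewrite e1 mulKg.
have meetP d (x x1 n : W) : P d x -> P d x1 -> is_meet x x1 n -> P d n.
  move=> [dx tx] [dy ty] xyn; have [dn xyn'] := meet_mull dx dy xyn.
  by split=> //; exact: transports_meet tx ty xyn'.
have near12 : \forall q \near U, P d1 (pos q z) /\ P d2 (pos q z).
  exact: filterI (nearP _ zd1) (nearP _ zd2).
have [q [P1q P2q]] := filter_ex near12.
have [b [P1b P2b] bmin] := @least_of_meet_closed W
  [set b | P d1 b /\ P d2 b] (pos q z) (conj P1q P2q)
  (fun x x1 n Px Py xyn => conj (meetP d1 x x1 n Px.1 Py.1 xyn)
                               (meetP d2 x x1 n Px.2 Py.2 xyn)).
(* Leastness frees [b] from the chosen [q]: eventually the positions of [z] satisfy both conditions,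
   hence are above [b]. *)
have bz : \forall q \near U, wle b (pos q z) by apply: filterS near12 => q'; exact: bmin.
have [m1 [dm1 rm1 zm1 zm1r]] := reach_between zd1 P1b.1 bz.
have [m2 [dm2 rm2 zm2 zm2r]] := reach_between zd2 P2b.1 bz.
have m12 : m1 = m2 by apply: (reach_inj zm1r zm2r); rewrite zm1 zm2.
exists m1; [|rewrite m12]; split=> // s sf.
  by rewrite dm1; exact: (P1b.2 s sf).2.
by rewrite dm2; exact: (P2b.2 s sf).2.
Qed.

(** Successors can be translated along a flat: [b] conjugates [delta c c'] into the parabolic
    subgroup of [flats d'], so the chamber [d] at distance [b] from [c] can be taken in the flat of
    [d']. *)
Lemma prec_coflat c c' d' : coflat c c' -> prec c' d' ->
  exists2 d, prec c d & coflat d d'.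
Proof.
move=> cc' c'd'; have fE := coflat_flats cc'; set b := delta c' d'.
have tb : transports (flats c') b := prec_transports c'd'.
have kb : parabolic (flats d') (b^-1 * delta c c' * b).
  have : parabolic (flats c') (delta c c') by rewrite fE.
  move: (delta c c'); apply: parabolic_ind; first by rewrite mulg1 mulVg; exact: parabolic1.
  move=> s x sf _ _ h; have [_ [t te]] := tb s sf.
  have -> : b^-1 * (g s * x) * b = g t * (b^-1 * x * b).
    by rewrite -(mulKg b (g t)) -te; gsimp.
  by apply: parabolicM => //; apply: parabolic_gen; exact: prec_flats te.
have cd' : delta c d' = delta c c' * b.
  apply: delta_comp; apply: (@lreduced_add _ (flats c')); last by rewrite fE; exact: cc'.
  by move=> s /tb[].
have [d cd dd'] := delta_step c d' b.
have fdd' : coflat d' d.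
  by rewrite /coflat /residue_of /= (deltaV d) dd' cd' mulgA; exact: parabolicV.
exists d; last exact: coflat_sym.
split; last by rewrite cd -fE => s /tb[].
apply: filterS3 (coflat_pos cc') (coflat_pos fdd') c'd'.1 => q e1 e2 [e3 e4].
by rewrite cd -e1 e2.
Qed.

Definition sees z c : Prop := exists2 d, prec z d & coflat d c.

Lemma sees_prec z c d : sees z c -> prec c d -> sees z d.
Proof.
move=> [e ze ec] cd; have [e' ee' e'd] := prec_coflat ec cd.
by exists e' => //; exact: prec_trans ee'.
Qed.

(** The relation [R] is symmetric, and transitive by confluence. Adjacent chambers are related,
    being coflat or having a common pole; a gallery from [y] to [z] concludes. *)
Lemma sees_directed y z : exists2 c, prec y c & sees z c.
Proof.
pose R y z := exists2 c, prec y c & sees z c.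
have Rsym y1 y2 : R y1 y2 -> R y2 y1.
  by move=> [c y1c [d y2d dc]]; exists d => //; exists c => //; exact: coflat_sym.
have Rtrans y1 y2 y3 : R y1 y2 -> R y2 y3 -> R y1 y3.
  move=> [c y1c [d y2d dc]] [d' y2d' [c' y3c' c'd']].
  have [m dm d'm] := prec_confluent y2d.1 y2d'.1.
  have [m1 cm1 m1m] := prec_coflat (coflat_sym dc) dm.
  exists m1; first exact: prec_trans cm1.
  have [m2 m2m /coflat_trans h] := sees_prec (ex_intro2 _ _ c' y3c' c'd') d'm.
  by exists m2 => //; apply: h; exact: coflat_sym.
have Rpole y1 e s : residue_of [set s]%SET y1 e -> pole e s -> R y1 e.
  move=> /parabolic_set1[/delta_eq1->|y1e] es.
    by exists e; [exact: prec_refl|exists e; [exact: prec_refl|exact: coflat_refl]].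
  have y1er : reach y1 e.
    apply: filterS (pole_other y1e es) => q [e1 e2].
    by rewrite y1e e1 -e1 e2 cox_length_gen add1n.
  have [m h1 h2] := prec_confluent (reach_refl y1) y1er.
  by exists m => //; exists m => //; exact: coflat_refl.
have Radj y1 y2 s : delta y1 y2 = g s -> R y1 y2.
  move=> y12; have y12r : residue_of [set s]%SET y1 y2.
    by rewrite /residue_of /= y12; apply: parabolic_gen; rewrite inE.
  have [sf|[e ye es]] := panel_dichotomy y1 s.
    exists y1; first exact: prec_refl.
    exists y2; first exact: prec_refl.
    apply: coflat_sym; apply: parabolicS y12r => t; rewrite !inE => /eqP->.
    exact: sf.
  apply: (Rtrans _ e); first exact: Rpole es.
  apply: Rsym; apply: Rpole es; exact: residue_trans (residue_sym y12r) ye.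
have [u uE _] := reduced_word (delta y z).
have := chain_ex (esym uE); elim: u y {uE} => [|s u IH] y /=.
  by move=> ->; exists z; [exact: prec_refl|exists z; [exact: prec_refl|exact: coflat_refl]].
by move=> [y' yy' /IH]; apply: Rtrans; exact: Radj yy'.
Qed.

Lemma cofinal_sequence y : exists u : nat -> X,
  [/\ u 0%N = y, forall n, prec (u n) (u n.+1) &
    forall z, exists N, forall n, (N <= n)%N -> sees z (u n)].
Proof.
(* An enumeration of [W] with repetitions; codes of no word are sent to the empty word. Stage [n]
   treats the chamber reachable from [y] at distance [a n], if there is one. *)
pose a n : W := wd (odflt [::] (unpickle n)).
have next n c : exists c', prec c c' /\
    forall d, reach y d -> delta y d = a n -> sees d c'.
  have [[d [yd dn]]|no] := pselect (exists d, reach y d /\ delta y d = a n).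
    have [c' cc' dc'] := sees_directed c d; exists c'; split=> // d' yd' d'n.
    by rewrite (@reach_inj y d' d)// dn.
  by exists c; split=> [|d yd dn]; [exact: prec_refl|case: no; exists d].
pose u := fix u n := if n is n'.+1 then sval (cid (next n' (u n'))) else y.
have uS n : prec (u n) (u n.+1) by rewrite /=; case: cid => c' [].
exists u; split=> // z.
have [c yc [d zd dc]] := sees_directed y z.
have [v vE _] := reduced_word (delta y c).
(* The chamber [c] is treated in passing from rank [pickle v] to the next one, whence the successor;
   [sees_prec] propagates to later ranks. *)
exists (pickle v).+1; elim=> [//|n IH]; rewrite leq_eqVlt => /orP[/eqP[vn]|]; last first.
  by move=> /IH h; exact: sees_prec (uS n).
have [e ce eu] : sees c (u n.+1).
  rewrite /=; case: cid => c' [_ /=]; apply; first exact: yc.1.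
  by rewrite /a -vn pickleK /= vE.
have [e' de' e'e] := prec_coflat dc ce.
by exists e'; [exact: prec_trans de'|exact: coflat_trans eu].
Qed.

Lemma reach_sequence u : (forall n, prec (u n) (u n.+1)) ->
  forall i j, (i <= j)%N -> reach (u i) (u j).
Proof.
move=> uS i j /subnKC<-; elim: (j - i)%N => [|k IH].
  by rewrite addn0; exact: reach_refl.
by rewrite addnS; apply: reach_trans IH (uS _).1.
Qed.

(* z is any chamber of E. *)
Lemma proj_limit L Y E :
  (\forall q \near U, proj_chamber (residue_of L Y) @` residue_of q.1 q.2 = E) ->
  exists z, forall c, sees z c ->
    proj_chamber (residue_of L Y) @` residue_of (flats c) c = E.
Proof.
move=> HE; have [q0 q0E] := filter_ex HE.
have [e Ee] : E !=set0.
  by rewrite -q0E; exists (proj_chamber (residue_of L Y) q0.2); exists q0.2 => //; exact: residue_refl.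
exists e => c [d ed dc]; set b := delta e d.
have [q [[qE fe] [fd [e1 e2]]]] := filter_ex
  (filterI (filterI HE (near_flat_type e)) (filterI (near_flat_type d) ed.1)).
have [Ye eL] : residue_of L Y e /\ lreduced L (pos q e).
  by move: Ee; rewrite -qE proj_image.
have wde : wle b (pos q e) by rewrite e1; apply: wleM; rewrite -e1.
have bL : lreduced L b.
  by move=> s /eL h; have := wle_add wde; move=> /(_ (g s)); rewrite cox_length_gen !add1n; apply.
have fdc := coflat_flats dc.
(* [pos q e = b * pos q d] is shortest in its coset; a letter [t] flat at [d] and shortening [b]
   would give the shorter element [b t pos q d] of the same coset. *)
have bc : wpos (flats c) c e = b.
  apply: mrepE; last first.
    by apply: delta_parabolicr; rewrite fdc; exact: dc.
  move=> t; rewrite fdc -fd => /flat_typeP Jt.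
  have := rreduced_add (@mrep_rreduced _ q.1 (delta e q.2)) Jt.
  rewrite -/(pos q e) {1}e1 (_ : _ * _ * _ = b * g t * pos q d); last by gsimp.
  have [h|h] := cox_length_mulgenr t b; first by move=> _.
  have := cox_lengthM (b * g t) (pos q d); move: e2; rewrite -/b.
  by len_lia.
rewrite -qE (proj_image_residue Ye eL) (@proj_image_residue _ _ _ _ _ _ e) ?bc//.
(* The two types agree: conjugation by [b] carries [flats e] into [flats d] because [d] is a
   successor of [e], and flatness at [d] pulls back to [e] through [pos q e = b * pos q d]. *)
rewrite fe; congr (residue_of _ e); apply/setP => s; rewrite ![in LHS]inE ![in RHS]finset.in_setI.
congr (_ && _); apply/idP/idP.
  move=> /asboolP; rewrite fdc -fd => /flat_type_parabolic h.
  rewrite -fe; apply/flat_typeP; rewrite e1.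
  by rewrite (_ : _ * _ = (pos q d)^-1 * (b^-1 * g s * b) * pos q d)//; gsimp.
move=> sf; have [t te] := ed.2 s sf; apply/asboolP.
rewrite -mulgA te mulKg; apply: parabolic_gen.
by rewrite fdc; exact: prec_flats te.
Qed.

End LimitsOfResidues.

(** * Apartments and limits *)

Section ApartmentExtension.
Variables (W : coxeter_system) (X : building W).
Local Notation S := (cox_type W).
Local Notation g := (@cox_gen W).
Local Notation l := (@cox_length W).
Local Notation wd := (word_prod g).
Implicit Types (s : S) (w v : W) (G : set (W * X)) (p q : W * X).

(** [G] is the graph of a partial isometry from [W] to [X]; pairs with equal first entries are
    forced to coincide. *)
Definition isometric G : Prop :=
  forall p q, G p -> G q -> delta p.2 q.2 = p.1^-1 * q.1.

(* If w^-1 v0 starts with s, the new chamber is the projection of the chamber E0 of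
   v0 to the s-panel of C. Were another E at distance w^-1 v from it, delta E0 E
   would be read off a subword of s w^-1 v0, which is too short for w^-1 v0. *)
Lemma isometric_extend1 G w C s : isometric G -> G (w, C) ->
  exists D, forall q, G q -> delta D q.2 = (w * g s)^-1 * q.1.
Proof.
move=> isoG GC; have CE q : G q -> delta C q.2 = w^-1 * q.1 by exact: isoG GC.
have [[[v0 E0] [GE0 /= lt]]|no] := pselect (exists q, G q /\
    (l (g s * (w^-1 * q.1)) < l (w^-1 * q.1))%N); last first.
  have [D DC _] := delta_ex s C C; exists D => q Gq.
  rewrite invgM cox_genV -mulgA -(CE q Gq); apply: delta_adj_len DC _.
  rewrite (CE q Gq); have [//|h] := cox_length_mulgen s (w^-1 * q.1).
  by case: no; exists q; split=> //; rewrite h.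
have [D DC DE0] := delta_ex s C E0; exists D => q Gq.
rewrite invgM cox_genV -mulgA -(CE q Gq).
have [//|DE] := delta_adj q.2 DC.
have [u uE su] := reduced_word (delta D E0).
have [u' u'u] := delta_subword q.2 (esym uE).
rewrite DE (CE q Gq) (isoG _ _ GE0 Gq) /= mulgA => /mulIg.
move=> /(congr1 (fun x => x^-1)); rewrite invgM !invgK => e.
have {}e : w^-1 * v0 = wd u' by rewrite e mulKg.
have CE0 : delta C E0 = w^-1 * v0 := CE _ GE0.
have := cox_length_word u'; have := size_subseq u'u.
rewrite su DE0 CE0 -e => h1 h2; exfalso.
by move: lt; rewrite ltnNge (leq_trans h2 h1).
Qed.

Lemma isometric_apartment G p0 : isometric G -> G p0 ->
  exists2 A, apartments X A & forall p, G p -> A p.2.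
Proof.
move=> isoG Gp0.
(* Zorn's lemma is applied to the condition on [M] together with [G], so that the empty chain is
   covered. Maximality then closes the domain under right multiplication by generators. *)
have [M [isoM maxM]] : exists M, isometric (M `|` G) /\
    forall B, M `<` B -> ~ isometric (B `|` G).
  apply: Zorn_bigcup => F FP totF p q; case=> [[Y FY Yp]|Gp]; case=> [[Z FZ Zq]|Gq].
  - have [YZ|ZY] := totF Y Z FY FZ.
      by apply: (FP Z FZ); left => //; exact: YZ.
    by apply: (FP Y FY); left => //; exact: ZY.
  - by apply: (FP Y FY); [left|right].
  - by apply: (FP Z FZ); [right|left].
  - exact: isoG.
set H := M `|` G in isoM.
have step w C s : H (w, C) -> exists D, H (w * g s, D).
  move=> HC; have [D DH] := isometric_extend1 s isoM HC; exists D; left.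
  apply: contrapT => nM; apply: (maxM (M `|` [set (w * g s, D)])).
    split=> [|le]; first exact: subsetUl.
    by apply: nM; apply: le; right.
  have isoD p q : H p \/ p = (w * g s, D) -> H q \/ q = (w * g s, D) ->
      delta p.2 q.2 = p.1^-1 * q.1.
    move=> [Hp|->] [Hq|->] /=.
    - exact: isoM.
    - by rewrite deltaV (DH p Hp) !invgM !invgK.
    - exact: DH.
    - by rewrite delta_self mulVg.
  move=> p q Hp Hq; apply: isoD.
    by case: Hp => [[Mp|->]|Gp]; [left; left|right|left; right].
  by case: Hq => [[Mq|->]|Gq]; [left; left|right|left; right].
have dom w : exists C, H (w, C).
  have [u uE _] := reduced_word (p0.1^-1 * w).
  have -> : w = p0.1 * wd u by rewrite uE mulVKg.
  have : exists C, H (p0.1, C) by exists p0.2; right; case: (p0) Gp0.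
  elim: u (p0.1) {uE} => [|s u IH] v; first by rewrite word_prod_nil mulg1.
  by move=> [C /step-/(_ s)/IH]; rewrite word_prod_cons mulgA.
have [f fH] := choice dom.
exists (range f).
  by exists f => // v w; exact: (isoM (v, f v) (w, f w) (fH v) (fH w)).
move=> p Gp; exists p.1 => //; apply/delta_eq1.
by rewrite (isoM (p.1, f p.1) p) ?mulVg//; right.
Qed.

End ApartmentExtension.

Section Bordification.
Variables (W : coxeter_system) (X : building W).
Local Notation S := (cox_type W).
Local Notation g := (@cox_gen W).
Implicit Types (J K L : {set S}) (C Y : X) (I : set (set X)).

Lemma proj_image_star L Y J C :
  star (residue_of L Y) (proj_chamber (residue_of L Y) @` residue_of J C).
Proof.
have [y [Yy yL]] : exists y, residue_of L Y y /\ lreduced L (wpos J C y).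
  have : (proj_chamber (residue_of L Y) @` residue_of J C)
      (proj_chamber (residue_of L Y) C) by exists C => //; exact: residue_refl.
  by rewrite proj_image => h; eexists; exact: h.
split; last by rewrite proj_image => z [].
by rewrite (proj_image_residue Yy yL); exists (flat_type J (wpos J C y) :&: L)%SET, y.
Qed.

Lemma proj_residue_val L Y (r : residues X (residue_of L Y)) J C :
  val (proj_residue r (residue_of J C)) =
  proj_chamber (residue_of L Y) @` residue_of J C.
Proof.
rewrite /proj_residue.
exact: (@xgetPex _ _ [set E : star (residue_of L Y) | val E = _]
  (ex_intro _ (SigSub (mem_set (proj_image_star L Y J C))) erefl)).
Qed.

(** This serves both bordifications: [I] is the set of panels or of spherical residues. Recording
    that each [K n] is a flat type of some [r t] lets the caller check that the new residues are
    chambers, respectively spherical. *)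
Lemma limit_in_apartment I (IR : I `<=` residues X) (T : Type)
    (r : T -> {set S} * X) (xi : star_prod I) :
  panels X `<=` I ->
  closure (range (fun t => proj_family IR (residue_of (r t).1 (r t).2))) xi ->
  exists A (u : nat -> X) (K : nat -> {set S}),
  [/\ apartments X A, forall n, A (u n),
    forall n, exists t w, rreduced (r t).1 w /\ K n = flat_type (r t).1 w &
    proj_family IR (residue_of (K n) (u n)) @[n --> \oo] --> xi].
Proof.
set em := fun t => _; move=> panI clxi.
(* The image under [r] of the trace on [T] of the neighbourhood filter of [xi]. *)
pose U := filter_from (nbhs xi) (fun N => r @` (em @^-1` N)).
have UP : ProperFilter U.
  apply: filter_from_proper.
    apply: filter_from_filter; first by exists setT; exact: filterT.
    move=> N M nN nM; exists (N `&` M); first exact: filterI.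
    by move=> _ [t [Nt Mt] <-]; split; exists t.
  move=> N /clxi[_ [[t _ <-] Nt]]; exists (r t).
  by exists t.
have coord (s : I) : nbhs xi [set eta : star_prod I | eta s = xi s].
  pose T' (s : I) : topologicalType := discrete_topology (star (val s)).
  have := @proj_continuous _ T' s xi [set xi s].
  by apply; exact: (@discrete_set1 (discrete_topology (star (val s)))).
have imU L Y (IY : I (residue_of L Y)) :
    \forall q \near U, proj_chamber (residue_of L Y) @` residue_of q.1 q.2 =
      val (xi (SigSub (mem_set IY))).
  exists [set eta : star_prod I | eta (SigSub (mem_set IY)) = xi (SigSub (mem_set IY))].
    exact: coord.
  by move=> _ [t et <-]; rewrite /= -et /em /proj_family proj_residue_val.
have projU s y : exists E, \forall q \near U,
    proj_chamber (residue_of [set s]%SET y) @` residue_of q.1 q.2 = E.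
  have Iy : I (residue_of [set s]%SET y) by apply: panI; exists s, y.
  by eexists; exact: (imU _ _ Iy).
have [x _] := building_nonempty X.
have [u [u0 uS uz]] := cofinal_sequence UP projU x.
have uR := reach_sequence UP uS.
have [A aptA Au] : exists2 A, apartments X A & forall n, A (u n).
  (* Distances along the sequence multiply, so sending [delta x (u n)] to [u n] is a partial
     isometry. *)
  pose G := [set (delta x (u n), u n) | n in [set: nat]].
  have add i j : (i <= j)%N -> delta x (u j) = delta x (u i) * delta (u i) (u j).
    by move=> ij; rewrite -u0; have [] := reach_comp UP (uR _ _ (leq0n i)) (uR _ _ ij).
  have isoG : isometric G.
    move=> _ _ [i _ <-] [j _ <-] /=; have [ij|/ltnW ji] := leqP i j.
      by rewrite (add _ _ ij) mulKg.
    by rewrite (add _ _ ji) invgM mulgVK -deltaV.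
  have [|A aptA AG] := @isometric_apartment _ _ G (delta x (u 0%N), u 0%N) isoG.
    by exists 0%N.
  by exists A => // n; apply: (AG (delta x (u n), u n)); exists n.
exists A, u, (fun n => flats U (u n)); split=> //.
  move=> n; have := near_flat_type UP projU (u n) => -[N /clxi[_ [[t _ <-] Nt]] NH].
  exists t, (wpos (r t).1 (r t).2 (u n)); split; first exact: mrep_rreduced.
  by symmetry; apply: (NH (r t)); exists t.
(* Stars are discrete, so convergence means that every coordinate is eventually equal to that of
   [xi]. *)
have stable (s : I) : exists N, forall n, (N <= n)%N ->
    proj_family IR (residue_of (flats U (u n)) (u n)) s = xi s.
  have [L [Y sE]] := IR _ (set_valP s).
  case: s sE => sv sI /= sE; subst sv.
  have [z zm] := proj_limit UP projU (imU L Y (set_mem sI)).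
  have [N Nz] := uz z; exists N => n Nn; apply: val_inj.
  rewrite /proj_family proj_residue_val zm; last exact: Nz.
  by congr (val (xi (SigSub _))); exact: bool_irrelevance.
apply/cvg_sup => s V [B [[Q oQ QB] Bxi] BV].
have [N Ns] := stable s; exists N => // n Nn; apply: BV.
by rewrite -QB in Bxi *; rewrite /preimage /= (Ns n Nn).
Qed.

End Bordification.

Theorem proposition2p4 (W : coxeter_system) (X : building W) :
  bord1 X = \bigcup_(A in apartments X) bord1_apt A /\
  bord_sph X = \bigcup_(A in apartments X) bord_sph_apt A.
Proof.
split; apply/seteqP; split=> [xi clxi|xi [A _ []]//].
  have set1E (C : X) : residue_of finset.set0 C = [set C].
    apply/seteqP; split=> [D /parabolic_set0/delta_eq1 //|_ ->].
    exact: residue_refl.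
  pose r (C : X) := (finset.set0 : {set cox_type W}, C).
  have emE : (fun C => proj_family (@panels_residues W X)
      (residue_of (r C).1 (r C).2)) = @chamber_embed W X.
    by apply/funext => C; rewrite /= set1E.
  have clxi' := clxi; rewrite /bord1 -emE in clxi'.
  have [A [u [K [aptA Au Ku lim]]]] := limit_in_apartment (@subset_refl _ _) clxi'.
  exists A => //; split=> //; exists u; split=> //.
  (* With [J] empty, a flat direction [s] at [w] would satisfy [s w = w], contradicting that it
     lengthens [w]. *)
  suff KE n : K n = finset.set0.
    by move: lim; under eq_fun do rewrite KE set1E.
  have [t [w [wt ->]]] := Ku n; apply/setP => s; rewrite [in RHS]inE.
  apply/negbTE/negP => sf; have [+ _] := flat_type_gen wt sf.
  move/flat_typeP: sf => /parabolic_set0.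
  rewrite -mulgA => /mulg1_eq; rewrite invgK => <-.
  by lia.
have sphE (R : spherical_residues X) : exists q : {set cox_type W} * X,
    finite_set (parabolic q.1) /\ val R = residue_of q.1 q.2.
  by have [J [C [fJ RE]]] := set_valP R; exists (J, C).
have [r rE] := choice sphE.
have panS : panels X `<=` spherical_residues X.
  move=> _ [s [C ->]]; exists [set s]%SET, C; split=> //.
  apply: (@sub_finite_set _ _ [set 1; cox_gen s]).
    by move=> x /parabolic_set1[->|->]; [left|right].
  exact: finite_set2.
have emE : (fun t => proj_family (@spherical_residues_residues W X)
    (residue_of (r t).1 (r t).2)) = @residue_embed W X.
  by apply/funext => t; rewrite -(rE t).2.
have clxi' := clxi; rewrite /bord_sph -emE in clxi'.
have [A [u [K [aptA Au Ku lim]]]] := limit_in_apartment panS clxi'.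
have Ksph n : spherical_residues X (residue_of (K n) (u n)).
  exists (K n), (u n); split=> //; have [t [w [_ ->]]] := Ku n.
  (* The parabolic subgroup of a flat type lies in the conjugate of the finite group [W_J] by
     [w]. *)
  apply: (@sub_finite_set _ _ [set w * y * w^-1 | y in parabolic (r t).1]).
    move=> x /flat_type_parabolic h; exists (w^-1 * x * w) => //; gsimp.
    by [].
  by apply: finite_image; exact: (rE t).1.
exists A => //; split=> //.
exists (fun n => SigSub (mem_set (Ksph n))); split=> //.
by move=> n; exists (u n); split=> //; exact: residue_refl.
Qed.
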